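(* Let $M$ be an affine manifold modelled on the vector space $E$, either with trivial holonomy or real and finite-dimensional, and let $h\colon TM\to M$ be an affine map. Then $h$ is an algebra over the tangent functor monad if and only if there is an endomorphism $A\in\mathcal L(E)$ with $A^2=0$ such that $h(x,v)=x+Av$ for all $(x,v)\in TM$. Moreover, let $h$ and $k$ be affine algebras on affine manifolds $M$ and $N$ modelled on $E$ and $F$, given respectively by $A\in\mathcal L(E)$ and $B\in\mathcal L(F)$, and suppose that $M$ and $N$ have trivial holonomy. Then an affine map $f\colon M\to N$ is a morphism of algebras from $h$ to $k$ if and only if its linear part $\vec f\in\mathcal L(E,F)$ satisfies $\vec f\circ A=B\circ\vec f$.
   Context: $\mathbb K=\mathbb R$ or $\mathbb C$. An affine manifold is a (connected, paracompact, Hausdorff) manifold, modelled on a Banach space over $\mathbb K$, with an atlas whose coordinate changes are (locally) affine; an affine map is a map whose expression in affine charts is (locally) affine. If $M$ is an affine manifold, so is $TM$. An affine manifold has a canonical flat torsion-free connection; ''holonomy'' means the (linear) holonomy of this connection. For $(x,v)\in TM$, $x+v:=\exp_x(v)$ when defined, $\exp$ being the exponential map of this connection; an equation $h(x,v)=x+Av$ includes the assertion that the right side is defined. Absolute parallelism: if $M$ is an affine manifold with trivial holonomy modelled on $E$, $x_0\in M$ and $\Phi_0\colon T_{x_0}M\to E$ is an isomorphism, there is a unique vector bundle isomorphism $\Phi\colon TM\to M\times E$ extending $\Phi_0$ such that for every affine chart $(U,\phi)$ (with connected domain) the automorphism $\Phi_x\circ\phi'(x)^{-1}\in\mathcal L(E)$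 is independent of $x\in U$. Such a choice of $\Phi$ is fixed for every affine manifold with trivial holonomy. For $A\in\mathcal L(E)$ and $v\in T_xM$, $Av$ then means $\Phi_x^{-1}A\Phi_x v$. The linear part of an affine map $f\colon M\to N$ between affine manifolds with trivial holonomy, with parallelisms $\Phi,\Psi$, is $\vec f=\Psi_{f(x)}\circ T_xf\circ\Phi_x^{-1}\in\mathcal L(E,F)$, which is independent of $x$. If $M$ is real and finite-dimensional (with possibly non-trivial holonomy), let $p\colon M^\sharp\to M$ be its holonomy covering space (the covering with trivial holonomy whose deck group is the holonomy group of $M$; it exists by a theorem of Auslander and Markus), with absolute parallelism $\Phi$, and identify $T_aM^\sharp$ with $T_{p(a)}M$ via $T_ap$. For $v\in T_xM$, writing ''$Av$'' implies that all the endomorphisms $\Phi_a^{-1}A\Phi_a\in\mathcal L(T_xM)$, for $a\in p^{-1}(x)$, are equal, and $Av$ is the image of $v$ under this common endomorphism. An algebra over the tangent functor monad on $M$ is a map $h\colon TM\to M$ with $h(x,0)=x$ for all $x\in M$ and $h\circ Th=h\circ\mu_M$, where $\mu_M\colon T^2M\to TM$ is given in charts by $\mu_M(x,v,\dot x,\dot v)=(x,v+\dot x)$. A morphism from an algebra $h$ on $M$ to an algebra $k$ on $N$ is a map $f\colon M\to N$ with $f\circ h=k\circ Tf$. *)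

(* Defs.v *)
From HB Require Import structures.
From mathcomp Require Import all_boot all_order all_algebra.
From mathcomp Require Import complex.
From mathcomp Require Import boolp classical_sets functions cardinality set_interval.
From mathcomp Require Import reals interval_inference topology normedtype landau.
From mathcomp Require Import derive.
Import Order.TTheory GRing.Theory Num.Theory.
Import numFieldNormedType.Exports.

Set Implicit Arguments.
Unset Strict Implicit.
Unset Printing Implicit Defensive.

Local Open Scope classical_set_scope.
Local Open Scope ring_scope.

Section LocallyAffine.
Context {K : numFieldType}.

Definition locally_affine_at (E F : normedModType K) (f : E -> F) (z : E) :=
  exists2 L : {linear E -> F}, continuous L &
    \forall y \near z, f y = f z + L (y - z).

Lemma diff_affine_near (E F : normedModType K) (f : E -> F) (z : E)
    (L : {linear E -> F}) : continuous L ->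
  (\forall y \near z, f y = f z + L (y - z)) ->
  differentiable f z /\ 'd f z = L :> (E -> F).
Proof.
move=> cL fL.
have fE : f \o shift z = cst (f z) + L +o_ 0 id.
  apply/eqaddoP => _/posnumP[e].
  have : \forall y \near 0, f (y + z) = f z + L (y + z - z).
    by move: fL; rewrite (near_shift 0) subr0.
  apply: filterS => y yE.
  rewrite -[X in `|X|]/(f (y + z) - (f z + L y)).
  by rewrite yE addrK subrr normr0 mulr_ge0.
have dE := diff_unique cL fE.
by split => //; apply/diff_locallyP; rewrite dE.
Qed.

Lemma locally_affine_diff (E F : normedModType K) (f : E -> F) (z : E) :
  locally_affine_at f z -> [/\ differentiable f z, continuous ('d f z),
    \forall y \near z, f y = f z + 'd f z (y - z) &
    \forall y \near z, 'd f y = 'd f z :> (E -> F)].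
Proof.
move=> [L cL fL]; have [df dE] := diff_affine_near cL fL.
split; [exact: df|by rewrite dE|by rewrite dE|].
have fLL := near_join fL.
near=> y; rewrite dE.
have yE : f y = f z + L (y - z) by near: y.
apply: (diff_affine_near cL _).2.
have : \forall w \near y, f w = f z + L (w - z) by near: y.
apply: filterS => w ->; rewrite yE -addrA -linearD; congr (_ + L _).
by rewrite [RHS]addrC addrA subrK.
Unshelve. all: by end_near. Qed.

Lemma locally_affine_near (E F : normedModType K) (f g : E -> F) (z : E) :
  (\forall y \near z, f y = g y) -> locally_affine_at f z ->
  locally_affine_at g z /\ 'd f z = 'd g z :> (E -> F).
Proof.
move=> fg [L cL fL].
have gL : \forall y \near z, g y = g z + L (y - z).
  have fgz : f z = g z := nbhs_singleton fg.
  by near=> y; rewrite -(near fg y) // -fgz; near: y.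
split; first by exists L.
by rewrite (diff_affine_near cL fL).2 (diff_affine_near cL gL).2.
Unshelve. all: by end_near. Qed.

Lemma locally_affine_id (E : normedModType K) (z : E) :
  locally_affine_at (@id E) z /\ 'd (@id E) z = id :> (E -> E).
Proof.
have c : continuous (@idfun E) by move=> x; exact: cvg_id.
have H : \forall y \near z, id y = id z + idfun (y - z).
  by apply: nearW => y /=; rewrite subrKC.
by split; [exists idfun|rewrite (diff_affine_near c H).2].
Qed.

End LocallyAffine.

(* [bwd] is the inverse of [fwd] on the image of [dom]; its values elsewhere
   are irrelevant. *)
Record chart (K : numFieldType) (E : normedModType K) (T : Type) := Chart {
  dom : set T;
  fwd :> T -> E;
  bwd : E -> T;
  fwdK : forall x, dom x -> bwd (fwd x) = x;
  open_codom : open (fwd @` dom)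
}.

Definition affine_change (K : numFieldType) (E : normedModType K) (T : Type)
    (phi psi : chart E T) :=
  open (phi @` (dom phi `&` dom psi)) /\
  forall x, dom phi x -> dom psi x -> locally_affine_at (psi \o bwd phi) (phi x).

(* A set with an affine atlas; the topology of the underlying set is the one
   determined by the charts. As the atlas need not be maximal, [affine_chart]
   below describes the affine charts of the manifold. *)
Record affineAtlas (K : numFieldType) (E : normedModType K) := AffineAtlas {
  pt :> Type;
  atlas : set (chart E pt);
  chart_at : pt -> chart E pt;
  chart_atP : forall x, atlas (chart_at x);
  dom_chart_at : forall x, dom (chart_at x) x;
  atlas_change : forall phi psi, atlas phi -> atlas psi -> affine_change phi psi
}.

Section ManifoldTopology.
Context {K : numFieldType} {E : normedModType K} (M : affineAtlas E).

Definition atlas_open (W : set M) :=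
  forall phi, atlas phi -> open (phi @` (W `&` dom phi)).

Lemma atlas_openT : atlas_open setT.
Proof. by move=> phi _; rewrite setTI; exact: open_codom. Qed.

Lemma atlas_openI : setI_closed atlas_open.
Proof.
move=> A B oA oB phi aphi.
rewrite (_ : phi @` _ = phi @` (A `&` dom phi) `&` phi @` (B `&` dom phi)).
  by apply: openI; [exact: oA|exact: oB].
apply/seteqP; split=> [_ [x [[Ax Bx] dx] <-]|_ [[x [Ax dx] <-] [y [By dy] xy]]].
  by split; exists x.
exists x => //; split=> //; split=> //.
by rewrite -(fwdK dx) -xy fwdK.
Qed.

Lemma atlas_open_bigU (I : Type) (f : I -> set M) :
  (forall i, atlas_open (f i)) -> atlas_open (\bigcup_i f i).
Proof.
move=> oF phi aphi; rewrite setI_bigcupl image_bigcup.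
by apply: bigcup_open => i _; exact: oF.
Qed.

HB.instance Definition _ := gen_eqMixin (pt M).
HB.instance Definition _ := gen_choiceMixin (pt M).
HB.instance Definition _ := isOpenTopological.Build (pt M)
  atlas_openT atlas_openI atlas_open_bigU.

End ManifoldTopology.

Definition paracompact (T : topologicalType) :=
  forall C : set (set T), (forall U, C U -> open U) -> \bigcup_(U in C) U = setT ->
  exists D : set (set T), [/\ forall V, D V -> open V,
    \bigcup_(V in D) V = setT,
    forall V, D V -> exists2 U, C U & V `<=` U &
    forall x : T, exists2 W, nbhs x W & finite_set [set V | D V /\ V `&` W !=set0]].

Record affineManifold (K : numFieldType) (E : normedModType K) :=
  AffineManifold {
    am_atlas :> affineAtlas E;
    am_connected : connected [set: am_atlas];
    am_paracompact : paracompact am_atlas;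
    am_hausdorff : hausdorff_space am_atlas
  }.

Definition affine_chart (K : numFieldType) (E : normedModType K)
    (M : affineAtlas E) (phi : chart E M) :=
  forall psi, atlas psi -> affine_change phi psi /\ affine_change psi phi.

Definition affine_map (K : numFieldType) (E F : normedModType K)
    (M : affineAtlas E) (N : affineAtlas F) (f : M -> N) :=
  forall x phi psi, affine_chart phi -> affine_chart psi ->
    dom phi x -> dom psi (f x) ->
    (\forall z \near phi x, dom psi (f (bwd phi z))) /\
    locally_affine_at (psi \o f \o bwd phi) (phi x).

Section Tangent.
Context {K : numFieldType} {E : normedModType K} (M : affineAtlas E).

(* A tangent vector at [x] is represented by its coordinates in the preferred
   chart [chart_at x], so that T_xM is the space [E] for every [x]. *)
Record tangent := Tangent { foot : M; vec : E }.

(* The derivative T_xM -> E of a chart [phi] at [x]. *)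
Definition dchart (phi : chart E M) (x : M) : E -> E :=
  'd (phi \o bwd (chart_at x)) (chart_at x x).

Definition dchart_inv (phi : chart E M) (x : M) : E -> E :=
  'd (chart_at x \o bwd phi) (phi x).

Lemma change_comp (phi psi chi : chart E M) x :
  affine_change chi phi -> affine_change phi psi -> affine_change chi psi ->
  dom phi x -> dom psi x -> dom chi x -> forall v,
  'd (psi \o bwd phi) (phi x) ('d (phi \o bwd chi) (chi x) v) =
  'd (psi \o bwd chi) (chi x) v.
Proof.
move=> [ocp acp] [opp app] [_ acpsi] dp dq dc v.
have [d1 _ _ _] := locally_affine_diff (acp _ dc dp).
have [d2 _ _ _] := locally_affine_diff (app _ dp dq).
have e : (phi \o bwd chi) (chi x) = phi x by rewrite /= fwdK.
have := diff_comp d1; rewrite e => /(_ _ _ d2) H.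
rewrite -[LHS]/(('d (psi \o bwd phi) (phi x) \o 'd (phi \o bwd chi) (chi x)) v).
rewrite -H.
suff /locally_affine_near -/(_ (acpsi _ dc dq))[_ ->//] :
  \forall y \near chi x, (psi \o bwd chi) y =
     ((psi \o bwd phi) \o (phi \o bwd chi)) y.
have : nbhs (chi x) (chi @` (dom chi `&` dom phi)).
  by apply: open_nbhs_nbhs; split=> //; exists x.
apply: filterS => _ [y [cy py] <-] /=.
by rewrite (fwdK cy) (fwdK py).
Qed.

Lemma change_id (phi : chart E M) x : dom phi x ->
  locally_affine_at (phi \o bwd phi) (phi x) /\
  'd (phi \o bwd phi) (phi x) = id :> (E -> E).
Proof.
move=> dx; have [ai <-] := locally_affine_id (phi x).
have H : \forall y \near phi x, id y = (phi \o bwd phi) y.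
  have : nbhs (phi x) (phi @` dom phi).
    by apply: open_nbhs_nbhs; split; [exact: open_codom|exists x].
  by apply: filterS => _ [y dy <-] /=; rewrite fwdK.
by have [] := locally_affine_near H ai.
Qed.

Lemma dchartK (phi : chart E M) x : atlas phi -> dom phi x ->
  cancel (dchart phi x) (dchart_inv phi x).
Proof.
move=> aphi dx v; have dc := dom_chart_at x; have ac := chart_atP x.
rewrite /dchart /dchart_inv change_comp ?(change_id dc).2 //; exact: atlas_change.
Qed.

Lemma dchart_invK (phi : chart E M) x : atlas phi -> dom phi x ->
  cancel (dchart_inv phi x) (dchart phi x).
Proof.
move=> aphi dx v; have dc := dom_chart_at x; have ac := chart_atP x.
rewrite /dchart /dchart_inv change_comp ?(change_id dx).2 //; exact: atlas_change.
Qed.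

Definition tdom (phi : chart E M) : set tangent := [set X | dom phi (foot X)].
Definition tfwd (phi : chart E M) (X : tangent) : E * E :=
  (phi (foot X), dchart phi (foot X) (vec X)).
Definition tbwd (phi : chart E M) (z : E * E) : tangent :=
  Tangent (bwd phi z.1) ('d (chart_at (bwd phi z.1) \o bwd phi) (z.1) z.2).

Lemma tfwdK phi : atlas phi ->
  forall X, tdom phi X -> tbwd phi (tfwd phi X) = X.
Proof.
move=> aphi [x v] /= dx; rewrite /tbwd /tfwd /= fwdK //; congr Tangent.
exact: dchartK.
Qed.

Lemma tfwd_image phi (W : set M) : atlas phi -> W `<=` dom phi ->
  tfwd phi @` [set X | W (foot X)] = (phi @` W) `*` setT.
Proof.
move=> aphi Wd; apply/seteqP; split=> [_ [[x v] /= dx <-]|[z w] /= [[x dx <-] _]].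
  by split => //; exists x.
exists (Tangent x (dchart_inv phi x w)) => //.
by rewrite /tfwd /= dchart_invK //; exact: Wd.
Qed.

Lemma open_tfwd phi (W : set M) : atlas phi -> W `<=` dom phi ->
  open (phi @` W) -> open (tfwd phi @` [set X | W (foot X)]).
Proof.
move=> aphi Wd; rewrite tfwd_image// openE.
rewrite openE => oW [z w] [Wz _]; exists (phi @` W, setT) => /=.
  by split; [exact: oW|exact: filterT].
by move=> [a b] [].
Qed.

Definition tangent_chart phi (aphi : atlas phi) : chart (E * E)%type tangent :=
  Chart (tfwdK aphi) (open_tfwd aphi (fun x dx => dx) (open_codom phi)).


Definition tangent_atlas_set : set (chart (E * E)%type tangent) :=
  [set Phi | exists phi (aphi : atlas phi), Phi = tangent_chart aphi].

Definition pair_map (L : E -> E) (p : E * E) : E * E := (L p.1, L p.2).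

Lemma pair_map_linear (L : {linear E -> E}) : linear (pair_map L).
Proof. by move=> a u v; congr pair; rewrite /= linearP. Qed.

HB.instance Definition _ (L : {linear E -> E}) :=
  GRing.isLinear.Build K (E * E)%type (E * E)%type _ (pair_map L)
    (pair_map_linear L).

Lemma pair_map_continuous (L : {linear E -> E}) :
  continuous L -> continuous (pair_map L).
Proof.
move=> cL p; apply: cvg_pair.
- by apply: (@continuous_comp _ _ _ fst L); [exact: cvg_fst|exact: cL].
- by apply: (@continuous_comp _ _ _ snd L); [exact: cvg_snd|exact: cL].
Qed.

Lemma tangent_change_near phi psi (x : M) (w0 : E) : atlas phi -> atlas psi ->
  dom phi x -> dom psi x ->
  \forall p \near (phi x, w0),
    (tfwd psi \o tbwd phi) p =
      ((psi \o bwd phi) p.1, 'd (psi \o bwd phi) (phi x) p.2).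
Proof.
move=> aphi apsi dx px.
have [oW la] := atlas_change aphi apsi.
have [_ _ _ dL] := locally_affine_diff (la _ dx px).
have nW : nbhs (phi x) (phi @` (dom phi `&` dom psi)).
  by apply: open_nbhs_nbhs; split=> //; exists x.
have H := filterI nW dL.
exists (phi @` (dom phi `&` dom psi) `&` [set y | 'd (psi \o bwd phi) y =
    'd (psi \o bwd phi) (phi x) :> (E -> E)], setT).
  by split; [exact: H|exact: filterT].
move=> [z w] [/= [[y [dy py] <-] dE] _].
rewrite /tfwd /tbwd /= fwdK //; congr pair.
rewrite -dE; have ay := chart_atP y; have cy := dom_chart_at y.
by rewrite /dchart change_comp//; exact: atlas_change.
Qed.

Lemma tangent_change_affine phi psi X : atlas phi -> atlas psi ->
  tdom phi X -> tdom psi X ->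
  locally_affine_at (tfwd psi \o tbwd phi) (tfwd phi X) /\
  'd (tfwd psi \o tbwd phi) (tfwd phi X) =
    pair_map ('d (psi \o bwd phi) (phi (foot X))) :> (E * E -> E * E).
Proof.
case: X => x v aphi apsi /= dx px.
have [_ la] := atlas_change aphi apsi.
have [_ cL aL _] := locally_affine_diff (la _ dx px).
have H := tangent_change_near (dchart phi x v) aphi apsi dx px.
have cP := pair_map_continuous cL.
rewrite -[tfwd phi _]/(phi x, dchart phi x v).
suff P : \forall p \near (phi x, dchart phi x v),
    (tfwd psi \o tbwd phi) p = (tfwd psi \o tbwd phi) (phi x, dchart phi x v) +
      pair_map ('d (psi \o bwd phi) (phi x)) (p - (phi x, dchart phi x v)).
  by split; [exists (pair_map ('d (psi \o bwd phi) (phi x)))|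
             exact: (diff_affine_near cP P).2].
rewrite (nbhs_singleton H).
have A : \forall p \near (phi x, dchart phi x v), (psi \o bwd phi) p.1 =
    (psi \o bwd phi) (phi x) + 'd (psi \o bwd phi) (phi x) (p.1 - phi x).
  exists ([set z | (psi \o bwd phi) z =
    (psi \o bwd phi) (phi x) + 'd (psi \o bwd phi) (phi x) (z - phi x)], setT).
    by split; [exact: aL|exact: filterT].
  by move=> [z w] [].
apply: filterS2 H A => [[z w]] /= -> zE; congr pair => /=; first exact: zE.
by rewrite -[RHS]linearD subrKC.
Qed.

Lemma tangent_change Phi Psi :
  tangent_atlas_set Phi -> tangent_atlas_set Psi -> affine_change Phi Psi.
Proof.
move=> [phi [aphi ->]] [psi [apsi ->]]; split=> /=.
  have [oW _] := atlas_change aphi apsi.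
  by apply: (open_tfwd aphi _ oW) => x [].
by move=> X dX pX; exact: (tangent_change_affine aphi apsi dX pX).1.
Qed.

(* An [affineAtlas] suffices here: that T M is connected, paracompact and
   Hausdorff plays no role in the notion of an affine map T M -> M. *)
Definition tangentBundle : affineAtlas (E * E)%type :=
  @AffineAtlas K (E * E)%type tangent tangent_atlas_set
    (fun X => tangent_chart (chart_atP (foot X)))
    (fun X => ex_intro _ _ (ex_intro _ _ erefl))
    (fun X => dom_chart_at (foot X))
    tangent_change.

End Tangent.

(* In the preferred charts; [mu_chart] below is the formula
   (x, v, x', v') |-> (x, v + x') in an arbitrary chart. *)
Definition mu (K : numFieldType) (E : normedModType K) (M : affineAtlas E)
    (X : tangentBundle (tangentBundle M)) : tangentBundle M :=
  Tangent (foot (foot X)) (vec (foot X) + (vec X).1).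

Lemma mu_chart (K : numFieldType) (E : normedModType K) (M : affineAtlas E)
    (phi : chart E M) (aphi : atlas phi) (aTphi : @atlas _ _ (tangentBundle M) (tangent_chart aphi))
    (X : tangentBundle (tangentBundle M)) :
  dom (tangent_chart aTphi) X ->
  tangent_chart aphi (mu X) =
    ((tangent_chart aTphi X).1.1,
     (tangent_chart aTphi X).1.2 + (tangent_chart aTphi X).2.1).
Proof.
case: X => [[x v] [a b]] /= dx; rewrite /tfwd /=; congr pair.
have -> : @dchart _ _ (tangentBundle M) (tangent_chart aphi) (Tangent x v) (a, b) =
    pair_map (dchart phi x) (a, b).
  rewrite [LHS]/dchart /=.
  by rewrite (@tangent_change_affine _ _ M _ _ (Tangent x v) (chart_atP x) aphi (dom_chart_at x) dx).2.
by rewrite /dchart linearD.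
Qed.

Section TangentFunctor.
Context {K : numFieldType} {E F : normedModType K}.

Definition tmap (M : affineAtlas E) (N : affineAtlas F) (f : M -> N) (x : M) :
    E -> F :=
  'd (chart_at (f x) \o f \o bwd (chart_at x)) (chart_at x x).

Definition tangent_map (M : affineAtlas E) (N : affineAtlas F) (f : M -> N)
    (X : tangentBundle M) : tangentBundle N :=
  Tangent (f (foot X)) (tmap f (foot X) (vec X)).

End TangentFunctor.

Definition tangent_algebra (K : numFieldType) (E : normedModType K)
    (M : affineAtlas E) (h : tangentBundle M -> M) :=
  (forall x, h (Tangent x 0) = x) /\
  (forall X, h (tangent_map h X) = h (mu X)).

Definition algebra_morphism (K : numFieldType) (E F : normedModType K)
    (M : affineAtlas E) (N : affineAtlas F) (h : tangentBundle M -> M)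
    (k : tangentBundle N -> N) (f : M -> N) :=
  forall X, f (h X) = k (tangent_map f X).

Inductive real_or_complex (R : realType) : numFieldType -> Type :=
| RealScalars : real_or_complex R R
| ComplexScalars : real_or_complex R R[i].

Definition of_real (R : realType) (K : numFieldType)
    (k : real_or_complex R K) : R -> K :=
  match k in real_or_complex _ K return R -> K with
  | RealScalars => fun t => t
  | ComplexScalars => fun t => t%:C%C
  end.

Section Connection.
Context {R : realType} {K : numFieldType} (k : real_or_complex R K).
Context {E : normedModType K} (M : affineAtlas E).

Definition derivative_within (J : set R) (u : R -> E) (t : R) (l : E) :=
  (fun s => (of_real k (s - t))^-1 *: (u s - u t)) @ within J t^' --> l.

Definition near_chart (J : set R) (c : R -> M) (t : R) :=
  \forall s \near within J (nbhs t), dom (chart_at (c t)) (c s).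

Definition velocity (J : set R) (c : R -> M) (t : R) (w : E) :=
  near_chart J c t /\ derivative_within J (chart_at (c t) \o c) t w.

(* [V t] is a tangent vector at [c t]. The Christoffel symbols of the canonical
   connection vanish in affine charts, so that the covariant derivative of [V]
   along [c] is the derivative of its coordinates in an affine chart. *)
Definition covariant_derivative (J : set R) (c : R -> M) (V : R -> E) (t : R)
    (W : E) :=
  near_chart J c t /\
  derivative_within J (fun s => dchart (chart_at (c t)) (c s) (V s)) t W.

Definition geodesic (J : set R) (c : R -> M) (V : R -> E) :=
  forall t, J t -> velocity J c t (V t) /\ covariant_derivative J c V t 0.

(* [x + v] is defined and equal to [y] *)
Definition exp_to (x : M) (v : E) (y : M) :=
  exists c V, [/\ geodesic `[0, 1] c V, c 0 = x, V 0 = v & c 1 = y].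

Definition C1_on (J : set R) (c : R -> M) :=
  exists V : R -> E, forall t, J t -> velocity J c t (V t) /\
    (fun s => dchart (chart_at (c t)) (c s) (V s)) @ within J (nbhs t) --> V t.

Definition piecewise_C1 (c : R -> M) :=
  exists n (a : nat -> R), [/\ a 0%N = 0, a n = 1 &
    forall i, (i < n)%N -> a i < a i.+1 /\ C1_on `[a i, a i.+1] c].

Definition parallel (J : set R) (c : R -> M) (V : R -> E) :=
  forall t, J t -> covariant_derivative J c V t 0.

(* [P] is the parallel transport of T_xM along a loop at [x] *)
Definition holonomy (x : M) (P : E -> E) :=
  exists c : R -> M, [/\ piecewise_C1 c, c 0 = x, c 1 = x &
    forall v, exists V, [/\ parallel `[0, 1] c V, V 0 = v & V 1 = P v]].

Definition trivial_holonomy := forall x P, holonomy x P -> P =1 id.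

End Connection.

(* [par x] is Phi_x : T_xM -> E. Smoothness of Phi need not be required, since
   Phi has constant coefficients in the charts with connected domain. *)
Record absolute_parallelism (K : numFieldType) (E : normedModType K)
    (M : affineAtlas E) := AbsoluteParallelism {
  par :> M -> {linear E -> E};
  par_inv : M -> {linear E -> E};
  par_continuous : forall x, continuous (par x);
  par_inv_continuous : forall x, continuous (par_inv x);
  parK : forall x, cancel (par x) (par_inv x);
  par_invK : forall x, cancel (par_inv x) (par x);
  par_constant : forall phi : chart E M, affine_chart phi ->
    connected (dom phi) ->
    exists C : E -> E, forall x, dom phi x ->
      forall v, par x v = C (dchart phi x v)
}.

(* [A v] for [v] in T_xM *)
Definition par_act (K : numFieldType) (E : normedModType K)
    (M : affineAtlas E) (Phi : absolute_parallelism M) (A : E -> E) (x : M)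
    (v : E) : E := par_inv Phi x (A (Phi x v)).

(* For affine [f] this does not depend on [x]. *)
Definition linear_part (K : numFieldType) (E F : normedModType K)
    (M : affineAtlas E) (N : affineAtlas F) (Phi : absolute_parallelism M)
    (Psi : absolute_parallelism N) (f : M -> N) (x : M) (e : E) : F :=
  Psi (f x) (tmap f x (par_inv Phi x e)).

Section Covering.

Definition covering_map (S T : topologicalType) (p : S -> T) :=
  [/\ continuous p, range p = setT &
    forall x, exists2 U, open_nbhs x U & exists D : set (set S),
      [/\ p @^-1` U = \bigcup_(V in D) V, trivIset D id &
        forall V, D V -> open V /\ exists q : T -> S,
          [/\ {within U, continuous q},
              forall y, U y -> V (q y) /\ p (q y) = y &
              forall a, V a -> q (p a) = a]]].

Definition deck_transformation (S T : topologicalType) (p : S -> T)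
    (g : S -> S) :=
  [/\ continuous g, (exists g', [/\ continuous g', cancel g g' & cancel g' g]) &
    forall a, p (g a) = p a].

Context {R : realType} {E : completeNormedModType R}.
Context {M M' : affineManifold E} (p : M' -> M) (Phi : absolute_parallelism M').

(* The last two conditions say that taking linear parts identifies the deck
   group with the holonomy group of [M], when T_xM is identified with [E] by
   means of [Phi a] and of the tangent map of [p] at a point [a] over [x]. *)
Definition holonomy_covering :=
  [/\ covering_map p, affine_map p & trivial_holonomy (RealScalars R) M'] /\
  [/\ forall a b, p a = p b -> exists2 g, deck_transformation p g & g a = b,
      forall g g' a, deck_transformation p g -> deck_transformation p g' ->
        linear_part Phi Phi g a =1 linear_part Phi Phi g' a -> g =1 g' &
      forall a (L : E -> E),
        (exists2 g, deck_transformation p g & linear_part Phi Phi g a =1 L) <->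
        (exists2 P, holonomy (RealScalars R) (p a) P &
          forall w, P (tmap p a w) = tmap p a (par_act Phi L a w))].

(* [B] is the common value of the endomorphisms of T_xM induced by [A] at the
   points [a] over [x]. *)
Definition common_action (A : E -> E) (x : M) (B : E -> E) :=
  forall a, p a = x -> forall w, B (tmap p a w) = tmap p a (par_act Phi A a w).

End Covering.

Definition finite_dimensional (K : numFieldType) (E : lmodType K) :=
  exists (n : nat) (b : 'I_n -> E), forall v, exists a : 'I_n -> K,
    v = \sum_(i < n) a i *: b i.

(* Main.v *)
Require Import Defs.
From HB Require Import structures.
From mathcomp Require Import all_boot all_order all_algebra.
From mathcomp Require Import complex.
From mathcomp Require Import boolp classical_sets functions set_interval.
From mathcomp Require Import reals topology normedtype derive.
Import Order.TTheory GRing.Theory Num.Theory.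
Import numFieldNormedType.Exports.

Set Implicit Arguments.
Unset Strict Implicit.
Unset Printing Implicit Defensive.

Local Open Scope classical_set_scope.
Local Open Scope ring_scope.

(** An affine map carries geodesics to geodesics ([geodesic_image]), its tangent
map has constant coefficients in affine charts ([tmap_near]), and on a Hausdorff
affine manifold a geodesic on [[0, 1]] is determined by its initial vector
([geodesic_unique]). The theorem follows from these three facts.

Let [h : TM -> M] be affine. The derivative of [h] along the fibre T_xM at the
zero vector is an endomorphism [B x] of T_xM ([vertical h x]). Suppose that [h]
is an algebra. Since h(y,0) = y, the field [B] has constant coefficients in
affine charts ([vertical_parallel]). The curve s |-> h(x,sv) is a geodesic
with initial vector [B x v], so that h(x,v) = x + B_x v ([vertical_exp]). The
associativity law at the vector (0,w) tangent to [TM] at (x,0) reads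
h(x, B_x w) = x, and its derivative at w = 0 is the equation B_x^2 = 0
([vertical_sqr]).

Conversely, let h(x,v) = x + B_x v for a parallel field [B] with B_x^2 = 0. By
uniqueness of geodesics, h(x,0) = x and the derivative of [h] along the fibre is
[B x], so that Th(a,b) = a + B_x b at (x,0), and therefore B(Th(a,b)) = Th(0,a)
there. Both sides of this equation have constant coefficients in charts along
t |-> (x,tv), hence it holds on all of [TM] ([exp_field_tmap]). It says that the
geodesic s |-> h(x,v+sa) and the geodesic that ends at h(h(x,v), Th(a,b)) have the
same initial vector. So their ends agree, which is the associativity law
([exp_field_algebra]).

It remains to compare parallel fields on [M] with endomorphisms [A] of [E]. Both
the identity of a manifold with trivial holonomy and the holonomy covering
M^# -> M are surjective local isomorphisms [p : M' -> M] from a connected manifold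
with an absolute parallelism. A parallel field on [M], pulled back along [p] and
read in the parallelism, is locally constant, hence constant; and a field
with constant pullback is parallel, because [p] has local sections. Thus
parallel fields correspond to the endomorphisms [A] whose action descends to
[M] ([tangent_algebraP]).

For the morphisms, f(h(x,sv)) and l(f(x), s Tf v) are geodesics with initial
vectors Tf(Av) and B(Tf v). They agree for all [v] if and only if the linear
part of [f] at [x] intertwines [A] and [B], and the linear part does not depend
on [x] ([algebra_morphismP]). *)

(** * Neighbourhoods, connectedness and linear maps near the origin *)

Lemma cvg_near (T U : Type) (G : set_system T) (H : set_system U) (c : T -> U)
    (P : U -> Prop) :
  c s @[s --> G] --> H -> (\forall y \near H, P y) -> \forall s \near G, P (c s).
Proof. by move=> cH /cH. Qed.

Lemma near_norm_lt (K : numFieldType) (V : pseudoMetricNormedZmodType K) (x : V) (e : K) :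
  0 < e -> \forall y \near x, `|x - y| < e.
Proof. by move=> e0; apply/nbhs_ballP; exists e => // y; rewrite -ball_normE. Qed.

(** Used to propagate along [[0, 1]] and along a connected manifold what holds in
each chart: the sets where [P] holds and where it fails are both relatively
open. *)
Lemma connected_locally_constant (T : topologicalType) (A : set T) (P : T -> Prop) :
  connected A ->
  (forall x, A x -> \forall y \near within A (nbhs x), P y <-> P x) ->
  forall x y, A x -> A y -> P x -> P y.
Proof.
move=> cA lc x y Ax Ay Px.
have lc' (Q : T -> Prop) : (forall x, A x -> Q x -> \forall y \near within A (nbhs x), Q y) ->
    exists2 C, open C & A `&` Q = A `&` C.
  move=> QH; exists (interior [set z | A z -> Q z]); first exact: open_interior.
  apply/seteqP; split=> z [Az Qz]; split=> //; first exact: QH.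
  exact: (nbhs_singleton Qz).
have [C oC CE] : exists2 C, open C & A `&` P = A `&` C.
  by apply: lc' => z Az Pz; apply: filterS (lc z Az) => w ->.
have [D oD DE] : exists2 C, open C & A `&` ~` P = A `&` C.
  by apply: lc' => z Az Pz; apply: filterS (lc z Az) => w /= ->.
suff : A `&` P = A by move=> /seteqP[_ /(_ y Ay)[]].
apply: cA; [by exists x|by exists C|].
exists (~` D); first exact: open_closedC.
apply/seteqP; split=> z [Az Pz]; split=> //.
  move=> Dz; suff : (A `&` ~` P) z by case.
  by rewrite DE.
apply: contrapT => nP; apply: Pz; suff : (A `&` D) z by case.
by rewrite -DE.
Qed.

(** Reduces statements about linear maps to a neighbourhood of the origin, where the
charts describe affine maps. *)
Lemma exists_small_multiple (K : numFieldType) (E : normedModType K)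
    (P : E -> Prop) w :
  (\forall u \near 0, P u) -> exists2 t : K, t != 0 & P (t *: w).
Proof.
move=> H; have c0 : t *: w @[t --> (0 : K)] --> (0 : E).
  by rewrite -[X in _ --> X](scale0r w); exact: scalel_continuous.
suff : \forall t \near 0^', t != 0 :> K /\ P (t *: w).
  by move=> /filter_ex[t []]; exists t.
by have := cvg_near c0 H; rewrite /dnbhs near_withinE; apply: filterS.
Qed.

Lemma linear_eq_near0 (K : numFieldType) (E F : normedModType K)
    (L L' : {linear E -> F}) : (\forall w \near 0, L w = L' w) -> L =1 L'.
Proof.
move=> /exists_small_multiple H w; have [t t0] := H w.
by rewrite !linearZ => /(scalerI t0).
Qed.

(** By homogeneity the local inverse [S] determines a global one, which is
continuous at 0 because it agrees with [S] there. *)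
Lemma linear_local_inverse (K : numFieldType) (E F : normedModType K)
    (L : {linear E -> F}) (S : F -> E) :
  S w @[w --> (0 : F)] --> (0 : E) -> (\forall w \near 0, L (S w) = w) ->
  (\forall u \near 0, S (L u) = u) ->
  exists2 L' : {linear F -> E}, continuous L' & cancel L L' /\ cancel L' L.
Proof.
move=> S0 LS SL.
have injL : injective L.
  move=> u u' uu'; apply/eqP; rewrite -subr_eq0; apply/eqP.
  have [t t0 tE] := exists_small_multiple (u - u') SL.
  apply: (scalerI t0); rewrite -tE linearZ linearB uu' subrr /= !scaler0.
  by rewrite -[X in S X](linear0 L) (nbhs_singleton SL).
have /choice[L' L'K] : forall w, exists u, L u = w.
  move=> w; have [t t0 tE] := exists_small_multiple w LS.
  by exists (t^-1 *: S (t *: w)); rewrite linearZ tE /= scalerA mulVf// scale1r.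
have lL' : linear L' by move=> c u v; apply: injL; rewrite linearP !L'K.
pose f : {linear F -> E} := HB.pack L' (GRing.isLinear.Build K F E *:%R L' lL').
exists f; last by split=> // u; apply: injL; rewrite L'K.
apply: continuousfor0_continuous; rewrite /prop_for /continuous_at [X in _ --> X](linear0 f).
apply: cvg_trans S0; apply: near_eq_cvg.
by apply: filterS LS => w wE; apply: injL; rewrite wE; exact/esym/L'K.
Qed.

(** * Curves with a real parameter in normed spaces over the scalar field *)

Section RealScalars.
Context {R : realType} {K : numFieldType} (k : real_or_complex R K).

Lemma of_real_zmod_morphism : zmod_morphism (of_real k).
Proof. by case: K / k => //= s t; rewrite rmorphB. Qed.

Lemma of_real_monoid_morphism : monoid_morphism (of_real k).
Proof. by case: K / k; split=> //= s t; rewrite rmorphM. Qed.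

HB.instance Definition _ :=
  GRing.isZmodMorphism.Build R K (of_real k) of_real_zmod_morphism.
HB.instance Definition _ :=
  GRing.isMonoidMorphism.Build R K (of_real k) of_real_monoid_morphism.

Lemma ler_of_real s t : (of_real k s <= of_real k t) = (s <= t).
Proof. by case: K / k => //=; rewrite lecR. Qed.

Lemma ltr_of_real s t : (of_real k s < of_real k t) = (s < t).
Proof. by case: K / k => //=; rewrite ltcR. Qed.

Lemma normr_of_real s : `|of_real k s| = of_real k `|s|.
Proof. by case: K / k => //=; rewrite normc_def /= expr0n addr0 sqrtr_sqr. Qed.

(** Norms of vectors over [K] have values in [K]; this turns them into real
numbers, to which the mean value theorem applies. *)
Lemma of_real_normr (x : K) : exists r, of_real k r = `|x|.
Proof.
case: K / k x => /= x; first by exists `|x|.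
by exists (Num.sqrt (complex.Re x ^+ 2 + complex.Im x ^+ 2)); rewrite normc_def.
Qed.

Lemma of_real_gt0 (e : K) : 0 < e -> exists2 d : R, 0 < d & of_real k d = e.
Proof.
move=> e0; have [d] := of_real_normr e; rewrite gtr0_norm// => de.
by exists d => //; rewrite -ltr_of_real de rmorph0.
Qed.

Lemma of_real_norm (E : normedModType K) :
  exists rn : E -> R, forall x, of_real k (rn x) = `|x|.
Proof.
have /choice[rn rnE] : forall x : E, exists r, of_real k r = `|x|.
  by move=> x; have [r] := of_real_normr `|x|; rewrite normr_id; exists r.
by exists rn.
Qed.

Lemma of_real_continuous : continuous (of_real k).
Proof.
move=> s; apply/cvgrPdist_lt => e /of_real_gt0[d d0 <-].
near=> t; rewrite -rmorphB normr_of_real ltr_of_real.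
by near: t; exact: (@near_norm_lt R R s).
Unshelve. all: by end_near. Qed.

Section Derivatives.
Context {E : normedModType K}.
Implicit Types (u : R -> E) (J : set R).

(** The form of the difference quotient without division, which also holds at
[s = t]. *)
Lemma derivative_withinP J u t l : derivative_within k J u t l <->
  forall e : R, 0 < e -> \forall s \near t, J s ->
    `|u s - u t - of_real k (s - t) *: l| <= of_real k (e * `|s - t|).
Proof.
have key s (e : R) : s != t ->
    (`|(of_real k (s - t))^-1 *: (u s - u t) - l| <= of_real k e) =
    (`|u s - u t - of_real k (s - t) *: l| <= of_real k (e * `|s - t|)).
  move=> st; have nz : of_real k (s - t) != 0 by rewrite fmorph_eq0 subr_eq0.
  rewrite -[in RHS](scalerKV nz (u s - u t)) -scalerBr normrZ normr_of_real mulrC rmorphM.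
  by rewrite ler_pM2r// -(rmorph0 (of_real k)) ltr_of_real normr_gt0 subr_eq0.
split=> [/cvgrPdist_le H e e0|H].
  have /H : 0 < of_real k e by rewrite -(rmorph0 (of_real k)) ltr_of_real.
  rewrite /dnbhs !near_withinE; apply: filterS => s sH Js.
  have [->|st] := eqVneq s t; first by rewrite !subrr normr0 mulr0 rmorph0 scale0r subr0 normr0.
  by rewrite -key// -normrN opprB sH.
apply/cvgrPdist_le => _ /of_real_gt0[e e0 <-].
rewrite /dnbhs !near_withinE; apply: filterS (H e e0) => s sH st Js.
by rewrite -normrN opprB key// sH.
Qed.

Lemma derivative_within_continuous J u t l :
  derivative_within k J u t l -> u s @[s --> within J (nbhs t)] --> u t.
Proof.
move=> /derivative_withinP /(_ 1 ltr01) H.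
have [r rE] := of_real_normr `|l|; rewrite normr_id in rE.
(* Near t the difference quotient is bounded by |l| + 1. *)
have r1 : 0 < r + 1.
  by rewrite ltr_wpDl// -ler_of_real rE rmorph0.
apply/cvgrPdist_le => _ /of_real_gt0[e e0 <-]; rewrite !near_withinE.
near=> s => Js.
rewrite -normrN opprB -(subrK (of_real k (s - t) *: l) (u s - u t)).
apply: (le_trans (ler_normD _ _)).
have -> : of_real k e = of_real k (e / (r + 1)) * of_real k (1 + r).
  by rewrite -rmorphM [1 + r]addrC divfK// gt_eqF.
apply: (@le_trans _ _ (of_real k `|s - t| * of_real k (1 + r))).
  rewrite -rmorphM mulrDr mulr1 [leRHS]rmorphD.
  apply: lerD; first by rewrite -[in leRHS](mul1r `|s - t|); apply: (near H s).
  by rewrite normrZ normr_of_real -rE rmorphM.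
rewrite -!rmorphM ler_of_real ler_wpM2r//; first by rewrite addrC ltW.
rewrite -normrN opprB; near: s; apply: filterS (near_norm_lt t (divr_gt0 e0 r1)) => s /ltW.
Unshelve. all: by end_near. Qed.

Lemma derivative_within_near J u v t l : J t ->
  (\forall s \near within J (nbhs t), u s = v s) ->
  derivative_within k J u t l -> derivative_within k J v t l.
Proof.
move=> Jt uv; have uvt : u t = v t by apply: (nbhs_singleton uv).
move=> /derivative_withinP H; apply/derivative_withinP => e e0.
have := H e e0; rewrite near_withinE in uv.
by apply: filterS2 uv => s suv + Js; rewrite -suv// -uvt; exact.
Qed.

Lemma derivative_within_subset J J' u t l : J' `<=` J ->
  derivative_within k J u t l -> derivative_within k J' u t l.
Proof.
move=> JJ /derivative_withinP H; apply/derivative_withinP => e e0.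
by apply: filterS (H e e0) => s sH /JJ.
Qed.

Lemma derivative_within_line J (z l : E) t :
  derivative_within k J (fun s => z + of_real k s *: l) t l.
Proof.
apply/derivative_withinP => e e0; near=> s => _.
rewrite opprD addrACA subrr add0r -scalerBl -rmorphB subrr normr0.
by rewrite -(rmorph0 (of_real k)) ler_of_real mulr_ge0// ltW.
Unshelve. all: by end_near. Qed.

Lemma derivative_withinB J u v t l m : derivative_within k J u t l ->
  derivative_within k J v t m ->
  derivative_within k J (fun s => u s - v s) t (l - m).
Proof.
move=> ul vm; rewrite /derivative_within.
under eq_fun => s do rewrite opprD opprK addrACA [- v s + _]addrC -(opprB (v s) (v t)) scalerBr.
exact: cvgB.
Qed.

(** The norm of [u s - u a] is a real function with zero derivative, so the mean
value theorem for real functions applies in any normed space over [K]. *)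
Lemma derivative_within_cst a b u : a <= b ->
  (forall s, `[a, b]%classic s -> derivative_within k `[a, b] u s 0) -> u b = u a.
Proof.
move=> ab du; have [rn rnE] := of_real_norm E.
pose g s := rn (u s - u a).
have gu s t : of_real k `|g s - g t| <= `|u s - u t|.
  rewrite -normr_of_real rmorphB /= !rnE (le_trans (ler_dist_dist _ _))//.
  by rewrite opprB addrA subrK.
have gH s : `[a, b]%classic s -> forall e, 0 < e ->
    \forall t \near s, `[a, b]%classic t -> `|g t - g s| <= e * `|t - s|.
  move=> /du/derivative_withinP H e e0; apply: filterS (H e e0) => t /[apply].
  by rewrite scaler0 subr0 => /(le_trans (gu _ _)); rewrite ler_of_real.
have [||c _] := @MVT_segment R g (fun=> 0) a b ab.
- move=> s sab; have sab' : `[a, b]%classic s by exact: subset_itv_oo_cc.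
  suff gs : h^-1 *: (g (h *: 1 + s) - g s) @[h --> 0^'] --> (0 : R).
    by apply: DeriveDef; [apply/cvg_ex; exists 0|exact: cvg_lim].
  apply/cvgr0Pnorm_le => e e0; rewrite /dnbhs near_withinE.
  have := gH s sab' e e0.
  have : \forall t \near s, `]a, b[%classic t.
    by apply: open_nbhs_nbhs; split=> //; exact: interval_open.
  rewrite (near_shift 0 s) (near_shift 0 s).
  rewrite subr0; apply: filterS2 => h /= hab H h0.
  rewrite normrZ normfV ler_pdivrMl ?normr_gt0// mulrC.
  have := H (subset_itv_oo_cc hab); rewrite addrK.
  by rewrite [_ *: 1]mulr1.
- apply/subspace_continuousP => s sab; apply/cvgrPdist_le => e e0.
  rewrite !near_withinE; apply: filterS2 (gH s sab 1 ltr01) (near_norm_lt s e0).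
  move=> t gst /ltW st tab; rewrite distrC (le_trans (gst tab))//.
  by rewrite mul1r distrC.
rewrite mul0r /g subrr => /eqP; rewrite subr_eq0 => /eqP/(congr1 (of_real k)).
rewrite !rnE normr0 => /eqP; rewrite normr_eq0 subr_eq0 => /eqP.
exact.
Qed.

(** At the end point 0 the derivative is one-sided; it is unique since 0 is a limit
point of [[0, 1]]. *)
Lemma derivative_within_unique (u : R -> E) l m :
  derivative_within k `[0, 1] u 0 l -> derivative_within k `[0, 1] u 0 m -> l = m.
Proof.
have : ProperFilter (within `[0, 1] (0 : R)^').
  split; last exact: within_filter.
  rewrite /within/dnbhs/within/= => /nbhs_ballP[d /= d0 H].
  have m0 : 0 < Num.min (d / 2) 1 by rewrite lt_min ltr01 divr_gt0.
  apply: (H (Num.min (d / 2) 1)) => /=.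
  - rewrite /ball/= sub0r normrN gtr0_norm// gt_min; apply/orP; left.
    by rewrite ltr_pdivrMr// ltr_pMr// ltr1n.
  - by rewrite gt_eqF.
  - by rewrite in_itv/= ltW//= ge_min lexx orbT.
by move=> PF; apply: cvg_unique.
Qed.

End Derivatives.

Lemma derivative_within_affine (E F : normedModType K) (g : E -> F) (u : R -> E) J t l :
  J t -> derivative_within k J u t l -> locally_affine_at g (u t) ->
  derivative_within k J (g \o u) t ('d g (u t) l).
Proof.
move=> Jt du /locally_affine_diff[_ cL gL _].
have uc := derivative_within_continuous du.
apply: (@derivative_within_near _ _ (fun s => g (u t) + 'd g (u t) (u s - u t))) => //.
  have H : \forall s \near within J (nbhs t), g (u s) = g (u t) + 'd g (u t) (u s - u t).
    exact: uc gL.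
  by near=> s; rewrite /= (near H s).
rewrite /derivative_within.
under eq_fun => s do rewrite [u t - _]subrr linear0 addr0 addrAC subrr add0r -linearZ_LR.
exact: (cvg_comp _ _ du (cL l)).
Unshelve. all: by end_near. Qed.

End RealScalars.

Lemma derivative_within_linear {R : realType} {K : numFieldType}
    (k : real_or_complex R K) (E F : normedModType K) (L : {linear E -> F})
    (u : R -> E) J t l : continuous L ->
  derivative_within k J u t l -> derivative_within k J (fun s => L (u s)) t (L l).
Proof.
move=> cL du; rewrite /derivative_within.
under eq_fun => s do rewrite -linearB -linearZ_LR.
exact: (cvg_comp _ _ du (cL l)).
Qed.

Arguments derivative_within_line {R K} k {E} J z l t.

(** A ball is the union of the real segments that join its points to the centre. *)
Lemma ball_connected (R : realType) (K : numFieldType)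
    (k : real_or_complex R K) (E : normedModType K) (z : E) (r : K) :
  0 < r -> connected (ball z r).
Proof.
move=> r0; pose seg (y : E) := [set z + of_real k t *: (y - z) | t in `[0, 1]%classic].
have J0 : `[0, 1]%classic (0 : R) by rewrite /= in_itv /= lexx ler01.
have J1 : `[0, 1]%classic (1 : R) by rewrite /= in_itv /= lexx ler01.
have -> : ball z r = \bigcup_(y in ball z r) seg y.
  apply/seteqP; split=> [y By|_ [y By [t t01 <-]]].
    by exists y => //; exists 1 => //; rewrite rmorph1 scale1r addrC subrK.
  move: By t01; rewrite -ball_normE /= in_itv /= => By /andP[t0 t1].
  rewrite opprD addNKr normrN normrZ; apply: le_lt_trans By.
  rewrite distrC ler_piMl// normr_of_real -(rmorph1 (of_real k)) ler_of_real.
  by rewrite ger0_norm.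
apply: bigcup_connected.
  by exists z => y _; exists 0 => //; rewrite rmorph0 scale0r addr0.
move=> y _; apply: connected_continuous_connected; first exact: segment_connected.
apply: continuous_subspaceT => t; apply: cvgD; first exact: cvg_cst.
by apply: (@cvg_comp _ _ _ (of_real k) (fun t => t *: (y - z)));
  [exact: of_real_continuous|exact: scalel_continuous].
Qed.

(** * Charts and affine maps near a point *)

Lemma locally_affine_continuous (K : numFieldType) (E F : normedModType K)
    (f : E -> F) z : locally_affine_at f z -> f y @[y --> z] --> f z.
Proof. by move=> /locally_affine_diff[df _ _ _]; exact: differentiable_continuous. Qed.

Lemma diff_chain (K : numFieldType) (E F G : normedModType K)
    (f : E -> F) (g : F -> G) (h : E -> G) z :
  locally_affine_at f z -> locally_affine_at g (f z) -> locally_affine_at h z ->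
  (\forall y \near z, h y = g (f y)) ->
  forall v, 'd h z v = 'd g (f z) ('d f z v).
Proof.
move=> /locally_affine_diff[df _ _ _] /locally_affine_diff[dg _ _ _] hh hE v.
have [_ ->] := locally_affine_near hE hh.
by have := diff_comp df dg; rewrite /comp => ->.
Qed.

Section ManifoldTopology.
Context {K : numFieldType} {E : normedModType K} (M : affineAtlas E).
Implicit Types (phi psi : chart E M) (x y : M) (P : set M).

Lemma atlas_affine_chart phi : atlas phi -> affine_chart phi.
Proof. by move=> aphi psi apsi; split; exact: atlas_change. Qed.

Lemma near_chart_image phi x : dom phi x ->
  \forall z \near phi x, dom phi (bwd phi z) /\ phi (bwd phi z) = z.
Proof.
move=> dx; have : nbhs (phi x) (phi @` dom phi).
  by apply: open_nbhs_nbhs; split; [exact: open_codom|exists x].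
by apply: filterS => _ [y dy <-]; rewrite fwdK.
Qed.

Lemma open_chart_preimage phi (O : set E) : atlas phi -> open O ->
  open ([set y | dom phi y /\ O (phi y)] : set M).
Proof.
move=> aphi oO; suff: atlas_open [set y | dom phi y /\ O (phi y)] by [].
move=> psi apsi; rewrite openE => _ [y [[dy Oy] py] <-].
have [opp app] := atlas_change apsi aphi.
have := locally_affine_continuous (app _ py dy).
move=> /(_ O) /=; rewrite fwdK// => /(_ (open_nbhs_nbhs (conj oO Oy))) H1.
have {}H1 : \forall z \near psi y, O (phi (bwd psi z)) by exact: H1.
have H2 : nbhs (psi y) (psi @` (dom psi `&` dom phi)).
  by apply: open_nbhs_nbhs; split=> //; exists y.
rewrite /interior /=.
apply: filterS2 H1 H2 => z + [w [pw dw] wz]; rewrite /= -wz fwdK// => Ow.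
by exists w.
Qed.

(** Properties that hold near a point can be checked in any chart of the atlas;
this is how the topology of the manifold is used below. *)
Lemma near_atlas phi x P : atlas phi -> dom phi x ->
  (\forall y \near x, P y) <-> (\forall z \near phi x, P (bwd phi z)).
Proof.
move=> aphi dx; split.
  rewrite /prop_near1 /= nbhsE => -[W [oW Wx] WP].
  have : nbhs (phi x) (phi @` (W `&` dom phi)).
    by apply: open_nbhs_nbhs; split; [exact: oW|exists x].
  by apply: filterS => _ [y [Wy dy] <-]; rewrite fwdK//; exact: WP.
rewrite {1}/prop_near1 /= nbhsE => -[O [oO Ox] OP].
rewrite /prop_near1 /= nbhsE; exists [set y | dom phi y /\ O (phi y)].
  by split=> //; exact: open_chart_preimage.
by move=> y [dy /OP /=]; rewrite fwdK.
Qed.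

Lemma near_dom phi x : atlas phi -> dom phi x -> \forall y \near x, dom phi y.
Proof.
move=> aphi dx; apply/(near_atlas _ aphi dx).
by apply: filterS (near_chart_image dx) => z [].
Qed.

Lemma chart_cvg phi x : atlas phi -> dom phi x -> phi y @[y --> x] --> phi x.
Proof.
move=> aphi dx P nP; apply/(near_atlas (fun y => P (phi y)) aphi dx).
by apply: filterS2 nP (near_chart_image dx) => z Pz [_ ->].
Qed.

Lemma bwd_cvg phi x : atlas phi -> dom phi x -> bwd phi z @[z --> phi x] --> x.
Proof. by move=> aphi dx P /(near_atlas _ aphi dx). Qed.

Lemma cvg_in_chart (T : Type) (G : set_system T) {FG : Filter G} (c : T -> M) phi x :
  atlas phi -> dom phi x -> (\forall s \near G, dom phi (c s)) ->
  phi (c s) @[s --> G] --> phi x -> c s @[s --> G] --> x.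
Proof.
move=> aphi dx dc cc P /(bwd_cvg aphi dx)/cc; rewrite /= => H.
by apply: filterS2 dc H => s ds; rewrite /= fwdK.
Qed.

Lemma dchart_continuous phi x : atlas phi -> dom phi x ->
  continuous (dchart phi x).
Proof.
move=> aphi dx; have [_ la] := atlas_change (chart_atP x) aphi.
by have [] := locally_affine_diff (la _ (dom_chart_at x) dx).
Qed.

Lemma dchart_at x v : dchart (chart_at x) x v = v.
Proof. by rewrite /dchart (change_id (dom_chart_at x)).2. Qed.

(** Coordinate changes are locally affine, so their derivatives are locally
constant. *)
Lemma dchart_near phi psi x : atlas phi -> atlas psi -> dom phi x -> dom psi x ->
  \forall y \near x, forall v,
    dchart psi y v = 'd (psi \o bwd phi) (phi x) (dchart phi y v).
Proof.
move=> aphi apsi dx px; have [_ la] := atlas_change aphi apsi.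
have [_ _ _ dL] := locally_affine_diff (la _ dx px).
have H := cvg_near (chart_cvg aphi dx) dL.
apply: filterS3 H (near_dom aphi dx) (near_dom apsi px) => y /= dE dy py v.
have ay := chart_atP y; have dyy := dom_chart_at y.
by rewrite -dE /dchart change_comp//; exact: atlas_change.
Qed.

Lemma dchart_near_at phi x : atlas phi -> dom phi x ->
  \forall y \near x, forall v,
    dchart phi y v = dchart phi x (dchart (chart_at x) y v).
Proof. move=> aphi dx; exact: dchart_near (chart_atP x) aphi (dom_chart_at x) dx. Qed.

Lemma dchart_inj phi x : atlas phi -> dom phi x -> injective (dchart phi x).
Proof. by move=> aphi dx; exact: can_inj (dchartK aphi dx). Qed.

End ManifoldTopology.

Section AffineMaps.
Context {K : numFieldType} {E F : normedModType K}.
Variables (M : affineAtlas E) (N : affineAtlas F) (f : M -> N).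
Hypothesis af : affine_map f.

Lemma affine_map_chart phi psi x : atlas phi -> atlas psi -> dom phi x ->
  dom psi (f x) -> (\forall y \near x, dom psi (f y)) /\
  locally_affine_at (psi \o f \o bwd phi) (phi x).
Proof.
move=> aphi apsi dx dfx.
have [H la] := af (atlas_affine_chart aphi) (atlas_affine_chart apsi) dx dfx.
by split=> //; apply/(near_atlas (fun y => dom psi (f y)) aphi dx).
Qed.

Lemma affine_map_cvg x : f y @[y --> x] --> f x.
Proof.
have ax := chart_atP x; have dx := dom_chart_at x.
have afx := chart_atP (f x); have dfx := dom_chart_at (f x).
have [H /locally_affine_continuous la] := affine_map_chart ax afx dx dfx.
apply: (cvg_in_chart afx dfx H) => P; move: la; rewrite /= (fwdK dx) => /[apply].
exact: (near_atlas (fun y => P (chart_at (f x) (f y))) ax dx).2.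
Qed.

(** [tmap] is defined by the preferred charts; by the chain rule, any charts of
the atlases give the same map. *)
Lemma tmap_chart phi psi x v : atlas phi -> atlas psi -> dom phi x ->
  dom psi (f x) ->
  dchart psi (f x) (tmap f x v) = 'd (psi \o f \o bwd phi) (phi x) (dchart phi x v).
Proof.
move=> aphi apsi dx dfx.
have ax := chart_atP x; have dax := dom_chart_at x.
have afx := chart_atP (f x); have dafx := dom_chart_at (f x).
have [H1 la1] := affine_map_chart ax afx dax dafx.
have [H2 la2] := affine_map_chart aphi apsi dx dfx.
have [H3 la3] := affine_map_chart ax apsi dax dfx.
have e1 : (chart_at (f x) \o f \o bwd (chart_at x)) (chart_at x x) = chart_at (f x) (f x).
  by rewrite /= fwdK.
have e2 : (phi \o bwd (chart_at x)) (chart_at x x) = phi x by rewrite /= fwdK.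
rewrite /dchart /tmap -[in LHS]e1 -[in RHS]e2.
rewrite -(diff_chain la1 _ la3); last 2 first.
- by rewrite e1; apply: (atlas_change afx apsi).2.
- move/(near_atlas _ ax dax) : H1; apply: filterS => z /= dz; by rewrite fwdK.
rewrite -(diff_chain (f := phi \o bwd (chart_at x)) _ _ la3) //.
- exact: (atlas_change ax aphi).2.
- by rewrite e2.
- have /(near_atlas _ ax dax) := near_dom aphi dx.
  by apply: filterS => z /= dz; rewrite fwdK.
Qed.

Lemma tmap_linear x : exists2 L : {linear E -> F}, continuous L & tmap f x =1 L.
Proof.
have ax := chart_atP x; have dx := dom_chart_at x.
have [_ /locally_affine_diff[_ cL _ _]] :=
  affine_map_chart ax (chart_atP (f x)) dx (dom_chart_at (f x)).
by exists ('d (chart_at (f x) \o f \o bwd (chart_at x)) (chart_at x x)).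
Qed.

(** The derivative of the expression of [f] in charts is locally constant, so only the
change of tangent coordinates at [y] remains. *)
Lemma tmap_near psi x : atlas psi -> dom psi (f x) ->
  \forall y \near x, dom psi (f y) /\ forall v,
    dchart psi (f y) (tmap f y v) = dchart psi (f x) (tmap f x (dchart (chart_at x) y v)).
Proof.
move=> apsi dfx; have ax := chart_atP x; have dx := dom_chart_at x.
have [H la] := affine_map_chart ax apsi dx dfx.
have [_ _ _ dL] := locally_affine_diff la.
have dL' := cvg_near (chart_cvg ax dx) dL.
apply: filterS3 H dL' (near_dom ax dx) => y dfy dE dy; split=> // v.
by rewrite (tmap_chart v ax apsi dy dfy) dE (tmap_chart _ ax apsi dx dfx) dchart_at.
Qed.

Lemma affine_near x :
  \forall y \near x, [/\ dom (chart_at x) y, dom (chart_at (f x)) (f y) &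
    chart_at (f x) (f y) = chart_at (f x) (f x) +
      tmap f x (chart_at x y - chart_at x x)].
Proof.
have ax := chart_atP x; have dx := dom_chart_at x.
have [H la] := affine_map_chart ax (chart_atP (f x)) dx (dom_chart_at (f x)).
have [_ _ dL _] := locally_affine_diff la.
have dL' := cvg_near (chart_cvg ax dx) dL.
apply: filterS3 H dL' (near_dom ax dx) => y dfy dE dy; split=> //.
by move: dE; rewrite /= !fwdK.
Qed.

End AffineMaps.

(** * Geodesics *)

Section Geodesics.
Context {R : realType} {K : numFieldType} (k : real_or_complex R K).

Section OneManifold.
Context {E : normedModType K} (M : affineAtlas E).
Implicit Types (J : set R) (c : R -> M) (V : R -> E).

Lemma velocity_cvg J c t w : velocity k J c t w ->
  c s @[s --> within J (nbhs t)] --> c t.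
Proof.
move=> [nc dc]; apply: (cvg_in_chart (chart_atP (c t)) (dom_chart_at (c t)) nc).
exact: derivative_within_continuous dc.
Qed.

Lemma velocity_unique c (w w' : E) : velocity k `[0, 1] c 0 w ->
  velocity k `[0, 1] c 0 w' -> w = w'.
Proof. by move=> [_ cw] [_ cw']; exact: derivative_within_unique cw cw'. Qed.

Lemma velocity_in_chart J c t w phi : J t -> atlas phi -> dom phi (c t) ->
  velocity k J c t w -> derivative_within k J (phi \o c) t (dchart phi (c t) w).
Proof.
move=> Jt aphi dt [nc dc].
have [_ la] := atlas_change (chart_atP (c t)) aphi.
have := derivative_within_affine Jt dc (la _ (dom_chart_at _) dt).
apply: derivative_within_near => //.
by near=> s; rewrite /= fwdK//; near: s.
Unshelve. all: by end_near. Qed.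

Lemma covariant_derivative_in_chart J c V t W phi : J t -> atlas phi ->
  dom phi (c t) -> c s @[s --> within J (nbhs t)] --> c t ->
  covariant_derivative k J c V t W ->
  derivative_within k J (fun s => dchart phi (c s) (V s)) t (dchart phi (c t) W).
Proof.
move=> Jt aphi dt cc [_ dV].
have := derivative_within_linear (dchart_continuous aphi dt) dV.
apply: derivative_within_near => //.
have H := cvg_near cc (dchart_near_at aphi dt).
by near=> s; rewrite (near H s).
Unshelve. all: by end_near. Qed.

(** In a chart the velocity of a geodesic has zero derivative, so it is constant,
and subtracting the line with this velocity leaves a curve with zero
derivative. *)
Lemma geodesic_near c V t phi : geodesic k `[0, 1] c V -> `[0, 1]%classic t ->
  atlas phi -> dom phi (c t) ->
  \forall s \near within `[0, 1] (nbhs t), [/\ dom phi (c s),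
    dchart phi (c s) (V s) = dchart phi (c t) (V t) &
    phi (c s) = phi (c t) + of_real k (s - t) *: dchart phi (c t) (V t)].
Proof.
move=> gc Jt aphi dt; have [vt _] := gc t Jt.
have := cvg_near (velocity_cvg vt) (near_dom aphi dt).
rewrite near_withinE => /nbhs_ballP[d /= d0 dH].
(* S is an interval around t on which the geodesic stays in the chart phi. *)
pose S := `[0, 1]%classic `&` ball t d.

have tS : S t by split=> //; exact: ballxx.
have convS a b s : S a -> S b -> a <= s <= b -> S s.
  move=> [/= Ja Ba] [/= Jb Bb] /andP[as_ sb]; split.
    move: Ja Jb; rewrite /= !in_itv /= => /andP[a0 _] /andP[_ b1].
    by rewrite (le_trans a0)// (le_trans sb).
  move: Ba Bb; rewrite /ball /= !ltr_distlC => /andP[a1 _] /andP[_ b2].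
  by rewrite (lt_le_trans a1)// (le_lt_trans sb).
have cst (u : R -> E) a b : (forall s, S s -> derivative_within k `[0, 1] u s 0) ->
    S a -> S b -> u a = u b.
  move=> du; wlog ab : a b / a <= b.
    by case: (leP a b) => [ab|/ltW ba] H Sa Sb; [exact: H|exact/esym/H].
  move=> Sa Sb; apply/esym; apply: (derivative_within_cst ab) => s /= sab.
  rewrite in_itv /= in sab.
  apply: (derivative_within_subset _ (du s (convS _ _ _ Sa Sb sab))) => r /=.
  by move=> rab; apply: (convS a b r Sa Sb _).1; move: rab; rewrite in_itv.
have dWS s : S s ->
    derivative_within k `[0, 1] (fun s => dchart phi (c s) (V s)) s 0.
  move=> [Js Bs]; have [vs cs] := gc s Js; have ds := dH s Bs Js.
  have := covariant_derivative_in_chart Js aphi ds (velocity_cvg vs) cs.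
  by rewrite /dchart linear0.
have WS s : S s -> dchart phi (c s) (V s) = dchart phi (c t) (V t).
  by move=> Ss; exact: (cst _ s t dWS).
have : \forall s \near t, ball t d s by exact: nbhsx_ballx.
rewrite near_withinE; apply: filterS => s Bs Js.
have Ss : S s by [].
split; [exact: dH|exact: WS|].
pose u r := phi (c r) - (phi (c t) + of_real k r *: dchart phi (c t) (V t)).
have : u s = u t.
  apply: (cst u s t) => // r Sr; have [Jr Br] := Sr.
  have [vr _] := gc r Jr; have dr := dH r Br Jr.
  rewrite -(subrr (dchart phi (c t) (V t))) -[in X in X - _](WS r Sr).
  apply: derivative_withinB; last exact: derivative_within_line.
  exact: (velocity_in_chart Jr aphi dr vr).
rewrite /u => /eqP; rewrite subr_eq => /eqP ->.
by rewrite opprD addNKr addrCA [- _ + _]addrC -scalerBl -rmorphB.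
Qed.

(** The times where two geodesics have the same position and velocity form an
open set by the local form of geodesics, and so do the times where they differ:
if the positions differ this is the Hausdorff property, and if only the
velocities differ it follows from the local form again. *)
Lemma geodesic_unique c V c' V' : hausdorff_space M ->
  geodesic k `[0, 1] c V -> geodesic k `[0, 1] c' V' ->
  c 0 = c' 0 -> V 0 = V' 0 -> c 1 = c' 1.
Proof.
move=> hM gc gc' c0 V0.
have J0 : `[0, 1]%classic (0 : R) by rewrite /= in_itv /= lexx ler01.
have J1 : `[0, 1]%classic (1 : R) by rewrite /= in_itv /= lexx ler01.
suff [] : c 1 = c' 1 /\ V 1 = V' 1 by [].
apply: (@connected_locally_constant R `[0, 1] (fun t => c t = c' t /\ V t = V' t)
  (@segment_connected _ 0 1) _ 0 1) => // t Jt.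
have [vt _] := gc t Jt; have [vt' _] := gc' t Jt.
have [cct|nct] := pselect (c t = c' t); last first.
  rewrite open_hausdorff in hM.
  have /eqP/hM[[A B] /= [/set_mem Act /set_mem Bct] [oA oB AB]] := nct.
  have HA := cvg_near (velocity_cvg vt) (open_nbhs_nbhs (conj oA Act)).
  have HB := cvg_near (velocity_cvg vt') (open_nbhs_nbhs (conj oB Bct)).
  near=> s; split=> -[] // cs _; exfalso.
  suff : (A `&` B) (c s) by rewrite (eqP AB).
  by split; [exact: (near HA s)|rewrite cs; exact: (near HB s)].
have a := chart_atP (c t); have d := dom_chart_at (c t).
have H := geodesic_near gc Jt a d.
have d' := d; rewrite [X in dom _ X]cct in d'.
have H' := geodesic_near gc' Jt a d'.
near=> s.
have [ds Ws cs] : [/\ dom (chart_at (c t)) (c s),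
    dchart (chart_at (c t)) (c s) (V s) = dchart (chart_at (c t)) (c t) (V t) &
    chart_at (c t) (c s) = chart_at (c t) (c t) + of_real k (s - t) *:
      dchart (chart_at (c t)) (c t) (V t)] by exact: (near H s).
have [ds' Ws' cs'] : [/\ dom (chart_at (c t)) (c' s),
    dchart (chart_at (c t)) (c' s) (V' s) = dchart (chart_at (c t)) (c' t) (V' t) &
    chart_at (c t) (c' s) = chart_at (c t) (c' t) + of_real k (s - t) *:
      dchart (chart_at (c t)) (c' t) (V' t)] by exact: (near H' s).
split=> [[es Vs]|[_ Vt]].
  split=> //; move: Ws' Ws; rewrite -es -cct -Vs => -> /(dchart_inj a d) //.
have es : c s = c' s.
  by rewrite -(fwdK ds) cs -(fwdK ds') cs' -cct Vt.
split=> //; apply: (dchart_inj a ds); rewrite Ws.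
by rewrite [in RHS]es Ws' -cct Vt.
Unshelve. all: by end_near. Qed.

Lemma geodesic_of_chart J c phi z w : atlas phi ->
  (forall s, J s -> dom phi (c s) /\ phi (c s) = z + of_real k s *: w) ->
  geodesic k J c (fun s => dchart_inv phi (c s) w).
Proof.
move=> aphi cJ t Jt; have [dt ct] := cJ t Jt.
have dJ : \forall s \near within J (nbhs t), dom phi (c s) /\
    phi (c s) = z + of_real k s *: w.
  by rewrite near_withinE; near=> s; exact: cJ.
have dphi : derivative_within k J (phi \o c) t w.
  have := derivative_within_line k J z w t; apply: derivative_within_near => //.
  by near=> s; rewrite /= (near dJ s _).2.
have cc : c s @[s --> within J (nbhs t)] --> c t.
  apply: (cvg_in_chart aphi dt); last exact: derivative_within_continuous dphi.
  by near=> s; exact: (near dJ s _).1.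
have a := chart_atP (c t); have d := dom_chart_at (c t).
have nc : near_chart J c t by exact: (cvg_near cc (near_dom a d)).
have [_ la] := atlas_change aphi a.
split; split => //.
  have := derivative_within_affine Jt dphi (la _ dt d).
  apply: derivative_within_near => //.
  near=> s; rewrite /= fwdK //; exact: (near dJ s _).1.
have := derivative_within_line k J ('d (chart_at (c t) \o bwd phi) (phi (c t)) w) 0 t.
apply: derivative_within_near => //.
have H := cvg_near cc (dchart_near aphi a dt d).
near=> s; rewrite scaler0 addr0.
have -> : dchart (chart_at (c t)) (c s) (dchart_inv phi (c s) w) =
  'd (chart_at (c t) \o bwd phi) (phi (c t)) (dchart phi (c s) (dchart_inv phi (c s) w)).
  exact: (near H s).
rewrite dchart_invK //; exact: (near dJ s _).1.
Unshelve. all: by end_near. Qed.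

Lemma geodesic_cst J x : geodesic k J (fun=> x : M) (fun=> 0).
Proof.
have := @geodesic_of_chart J (fun=> x) _ (chart_at x x) 0 (chart_atP x).
rewrite /dchart_inv linear0; apply=> s Js.
by rewrite scaler0 addr0; split=> //; exact: dom_chart_at.
Qed.

End OneManifold.

(** The velocity is constant because all the vectors at [x] have the same preferred
chart of [T M]. *)
Lemma geodesic_fibre {E : normedModType K} (M : affineAtlas E) J (x : M) (v a : E) :
  geodesic k J (fun t => Tangent x (v + of_real k t *: a) : tangentBundle M)
    (fun=> (0, a)).
Proof.
pose c t : tangentBundle M := Tangent x (v + of_real k t *: a).
pose phi : chart _ (tangentBundle M) := tangent_chart (chart_atP x).
have ax : atlas phi by exact: (@chart_atP _ _ (tangentBundle M) (Tangent x 0)).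
have dx t : dom phi (c t) by exact: dom_chart_at.
suff -> : (fun=> (0, a)) = fun s => dchart_inv phi (c s) (0, a).
  apply: (@geodesic_of_chart _ (tangentBundle M) J c phi (chart_at x x, v) (0, a) ax _) => s Js.
  split; first exact: dx.
  by rewrite /= /tfwd /= dchart_at; congr pair; rewrite /= scaler0 addr0.
apply: funext => s; rewrite /dchart_inv.
by rewrite (change_id (dx s)).2.
Qed.

Lemma geodesic_image {E F : normedModType K} (M : affineAtlas E)
    (N : affineAtlas F) (f : M -> N) J c V : affine_map f ->
  geodesic k J c V -> geodesic k J (f \o c) (fun t => tmap f (c t) (V t)).
Proof.
move=> af gc t Jt; have [vt [_ Wt]] := gc t Jt.
have a := chart_atP (c t); have d := dom_chart_at (c t).
have a' := chart_atP (f (c t)); have d' := dom_chart_at (f (c t)).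
have nfc := cvg_near (velocity_cvg vt) (tmap_near af a' d').
have nc : near_chart J (f \o c) t by apply: filterS nfc => s [].
split; split=> //.
  have [nct dt] := vt; have [_ la] := affine_map_chart af a a' d d'.
  have := derivative_within_affine Jt dt la.
  apply: derivative_within_near => //.
  by near=> s; rewrite /= fwdK//; near: s.
have [L cL LE] := tmap_linear af (c t).
have := derivative_within_linear cL Wt; rewrite linear0.
apply: derivative_within_near => //.
by near=> s; rewrite (near nfc s _).2 // dchart_at LE.
Unshelve. all: by end_near. Qed.

End Geodesics.

Arguments geodesic_cst {R K} k {E M} J x.
Arguments geodesic_fibre {R K} k {E M} J x v a.

(** * Affine tangent algebras and parallel fields of endomorphisms *)

(** Constancy of the coefficients in affine charts; only the preferred chart
of each point is mentioned, since the others differ from it by a locally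
constant matrix. *)
Definition parallel_field (K : numFieldType) (E : normedModType K)
    (M : affineAtlas E) (B : M -> E -> E) :=
  forall x, \forall y \near x, forall v,
    dchart (chart_at x) y (B y v) = B x (dchart (chart_at x) y v).

Lemma dchart_tangent (K : numFieldType) (E : normedModType K)
    (M : affineAtlas E) phi (aphi : atlas phi) (x : M) (v a b : E) : dom phi x ->
  dchart (tangent_chart aphi : chart _ (tangentBundle M)) (Tangent x v) (a, b) =
  (dchart phi x a, dchart phi x b).
Proof.
move=> dx; rewrite [LHS]/dchart /=.
have ax := chart_atP x; have dax := dom_chart_at x.
by rewrite (@tangent_change_affine _ _ M _ _ (Tangent x v) ax aphi dax dx).2.
Qed.

Section TangentAlgebras.
Context {R : realType} {K : numFieldType} (k : real_or_complex R K).
Context {E : normedModType K} (M : affineAtlas E) (h : tangentBundle M -> M).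
Hypothesis ah : affine_map h.

Lemma zero_section_cvg (x : M) :
  (Tangent y 0 : tangentBundle M) @[y --> x] --> (Tangent x 0 : tangentBundle M).
Proof.
have a := @chart_atP _ _ (tangentBundle M) (Tangent x 0).
have d := @dom_chart_at _ _ (tangentBundle M) (Tangent x 0).
have nd : \forall y \near x, dom (chart_at (Tangent x 0 : tangentBundle M))
    (Tangent y 0 : tangentBundle M).
  exact: near_dom (chart_atP x) (dom_chart_at x).
apply: (cvg_in_chart a d nd).
rewrite -[X in _ --> X]/(chart_at x x, dchart (chart_at x) x 0) dchart_at.
apply: cvg_pair; first exact: chart_cvg (chart_atP x) (dom_chart_at x).
rewrite /= /dchart; under eq_fun do rewrite linear0; exact: cvg_cst.
Qed.

Lemma fibre_cvg J (x : M) (v a : E) (t : R) : J t ->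
  (Tangent x (v + of_real k s *: a) : tangentBundle M) @[s --> within J (nbhs t)] -->
  (Tangent x (v + of_real k t *: a) : tangentBundle M).
Proof. by move=> /(geodesic_fibre k J x v a)[/velocity_cvg]. Qed.

Lemma tmap_split X a b : tmap h X (a, b) = tmap h X (a, 0) + tmap h X (0, b).
Proof.
have [L _ LE] := tmap_linear ah X; rewrite !LE -linearD; congr (L (_, _)).
  by rewrite /= addr0.
by rewrite /= add0r.
Qed.

(** When h(x,0) = x, this is the endomorphism [B x] of T_xM such that
h(x,v) = x + B_x v for small [v]. *)
Definition vertical (x : M) (v : E) : E := tmap h (Tangent x 0) (0, v).

Lemma vertical_linear x : exists2 L : {linear E -> E}, continuous L & vertical x =1 L.
Proof.
have [L cL LE] := tmap_linear ah (Tangent x 0).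
have lf : linear (vertical x).
  move=> c u v; rewrite /vertical !LE -linearP; congr (L (_, _)).
  by rewrite /= scaler0 addr0.
pose f : {linear E -> E} := HB.pack (vertical x)
  (GRing.isLinear.Build K E E *:%R (vertical x) lf).
exists f => // v; rewrite /continuous_at /= /vertical LE.
under eq_fun do rewrite LE.
apply: (@continuous_comp _ _ _ (fun v : E => (0 : E, v)) L); last exact: cL.
by apply: cvg_pair; [exact: cvg_cst|exact: cvg_id].
Qed.

Section Unit.
Hypothesis h0 : forall x, h (Tangent x 0) = x.

(** Differentiate h(y,0) = y. *)
Lemma tmap_horizontal x a : tmap h (Tangent x 0) (a, 0) = a.
Proof.
have [L _ LE] := tmap_linear ah (Tangent x 0).
have lf : linear (fun a => L (a, 0)).
  move=> c u v /=; rewrite -linearP; congr (L (_, _)).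
  by rewrite /= scaler0 addr0.
pose f : {linear E -> E} := HB.pack (fun a : E => L (a, 0))
  (GRing.isLinear.Build K E E *:%R (fun a => L (a, 0)) lf).
rewrite LE -[LHS]/(f a); apply: (@linear_eq_near0 _ _ _ f idfun).
have ax := chart_atP x; have dx := dom_chart_at x.
have /(near_atlas _ ax dx) := cvg_near (@zero_section_cvg x) (affine_near ah (Tangent x 0)).
rewrite (near_shift 0) subr0 /=.
have := near_chart_image dx; rewrite (near_shift 0) subr0 /=.
apply: filterS2 => w [dw bw] [_ _].
rewrite !h0 bw /= /tfwd /= bw dchart_at.
rewrite addrC => /addrI; rewrite LE => {2}->; congr (L (_, _)).
  by rewrite /= addrAC subrr add0r.
by rewrite /= /dchart linear0 subrr.
Qed.

Lemma vertical_parallel : parallel_field vertical.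
Proof.
move=> x; have ax := chart_atP x; have dx := dom_chart_at x.
have dx' : dom (chart_at x) (h (Tangent x 0)) by rewrite h0.
have := cvg_near (@zero_section_cvg x) (tmap_near ah ax dx').
apply: filterS2 (near_dom ax dx) => y dy [_ H] v.
by have := H (0, v); rewrite !h0 dchart_at dchart_tangent // /dchart linear0.
Qed.

(** The affine map [h] carries the line s |-> sv of T_xM to a geodesic. *)
Lemma vertical_exp x v : exp_to k x (vertical x v) (h (Tangent x v)).
Proof.
have := geodesic_image ah (geodesic_fibre k `[0, 1] x 0 v).
by move=> gc; do 2 eexists; split; first exact: gc;
  rewrite /= ?rmorph0 ?rmorph1 ?scale0r ?scale1r ?addr0 ?add0r.
Qed.

(** The vector (0,w) tangent to [T M] at (x,0) is mapped to (x, B_x w) by [T h] and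
to (x,0) by the multiplication of the monad, hence h(x, B_x w) = x for all
[w]; compare with h(x,v) = x + B_x v for small [v]. *)
Lemma vertical_sqr x v : (forall X, h (tangent_map h X) = h (mu X)) ->
  vertical x (vertical x v) = 0.
Proof.
move=> hmu; have [L cL LE] := vertical_linear x.
have hL w : h (Tangent x (L w)) = x.
  have := hmu (@Tangent _ _ (tangentBundle M) (Tangent x 0) (0, w)).
  rewrite /tangent_map /mu /= addr0 h0.
  by rewrite -[tmap _ _ _]/(vertical x w) LE.
rewrite !LE.
(* For small w the point (x, L w) of T M is where h(x,v) = x + L v. *)
have c0 : (Tangent x (L w) : tangentBundle M) @[w --> (0 : E)] -->
    (Tangent x 0 : tangentBundle M).
  have a := @chart_atP _ _ (tangentBundle M) (Tangent x 0).
  have d := @dom_chart_at _ _ (tangentBundle M) (Tangent x 0).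
  apply: (cvg_in_chart a d); first by apply: nearW => w; exact: dom_chart_at.
  rewrite /= /tfwd /=; under eq_fun do rewrite dchart_at; rewrite dchart_at.
  apply: cvg_pair; first exact: cvg_cst.
  by have := cL 0; rewrite /continuous_at linear0.
have H := cvg_near c0 (affine_near ah (Tangent x 0)).
have LL : linear (fun w => L (L w)) by move=> c u w /=; rewrite !linearP.
pose f : {linear E -> E} := HB.pack (fun w : E => L (L w))
  (GRing.isLinear.Build K E E *:%R (fun w => L (L w)) LL).
rewrite -[LHS]/(f v); apply: (@linear_eq_near0 _ _ _ f \0).
apply: filterS H => w [_ _]; rewrite hL h0 /= /tfwd /= !dchart_at.
move=> /(congr1 (fun z => - chart_at x x + z)); rewrite addNr addKr => tE.
rewrite -[RHS]/0 [RHS]tE -LE /vertical; congr tmap; congr pair; by rewrite /= ?subrr ?subr0.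
Qed.

End Unit.

Section Field.
Variable B : M -> E -> E.
Hypotheses (hM : hausdorff_space M) (pB : parallel_field B).
Hypothesis Bhom : forall x t v, B x (of_real k t *: v) = of_real k t *: B x v.
Hypothesis Bexp : forall x v, exp_to k x (B x v) (h (Tangent x v)).

Lemma exp_field_unit x : h (Tangent x 0) = x.
Proof.
have [c [V [gc c0 V0 <-]]] := Bexp x 0.
apply: (geodesic_unique hM gc (geodesic_cst k `[0, 1] x)) => //.
by rewrite V0; have := Bhom x 0 0; rewrite rmorph0 !scale0r.
Qed.

(** For small [t], the geodesic with initial vector t B_x v is a straight line in
the chart at [x]. It ends at h(x,tv), which is x + t L v in this chart, [L]
being the derivative of [h] along the fibre. *)
Lemma exp_field_vertical x v : vertical x v = B x v.
Proof.
have [L cL LE] := vertical_linear x; rewrite LE.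
have ax := chart_atP x; have dx := dom_chart_at x.
have /nbhs_ballP[r /= r0 rH] := near_chart_image dx.
have c0 : of_real k t *: B x v @[t --> (0 : R)] --> (0 : E).
  rewrite -[X in _ --> X](scale0r (B x v)) -(rmorph0 (of_real k)).
  by apply: (@cvg_comp _ _ _ (of_real k) (fun t => t *: B x v));
    [exact: of_real_continuous|exact: scalel_continuous].
have H1 : \forall t \near 0, `|of_real k t *: B x v| < r.
  by have := cvg_near c0 (near_norm_lt 0 r0); apply: filterS => t; rewrite sub0r normrN.
have H2 := @fibre_cvg setT x 0 v 0 I; rewrite rmorph0 scale0r addr0 in H2.
have {H2} := cvg_near H2 (affine_near ah (Tangent x 0)); rewrite near_withinE => H2.
have : \forall t \near (0 : R)^', L v = B x v; last by move=> /filter_ex[].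
rewrite /dnbhs near_withinE; near=> t => t0.
have tr : `|of_real k t *: B x v| < r by near: t.
pose X t : tangentBundle M := Tangent x (0 + of_real k t *: v).
pose X0 : tangentBundle M := Tangent x 0.
have [_ _] : [/\ dom (chart_at X0) (X t), dom (chart_at (h X0)) (h (X t)) &
    chart_at (h X0) (h (X t)) =
    chart_at (h X0) (h X0) + tmap h X0 (chart_at X0 (X t) - chart_at X0 X0)].
  exact: (near H2 t).
rewrite {}/X {}/X0.
rewrite exp_field_unit /= /tfwd /= !dchart_at add0r.
have -> : tmap h (Tangent x 0) ((chart_at x x, of_real k t *: v) - (chart_at x x, 0)) =
    of_real k t *: L v.
  rewrite -linearZ -LE /vertical; congr tmap; congr pair; by rewrite /= ?subrr ?subr0.
(* The straight line stays in the ball of radius r in the image of the chart. *)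
pose c s := bwd (chart_at x) (chart_at x x + of_real k s *: (of_real k t *: B x v)).
have cP s : `[0, 1]%classic s -> dom (chart_at x) (c s) /\
    chart_at x (c s) = chart_at x x + of_real k s *: (of_real k t *: B x v).
  rewrite /= in_itv /= => /andP[s0 s1].
  apply: rH; rewrite -ball_normE /= opprD addNKr normrN normrZ.
  apply: (le_lt_trans _ tr); rewrite ler_piMl// normr_of_real.
  by rewrite -(rmorph1 (of_real k)) ler_of_real ger0_norm.
have gc := geodesic_of_chart ax cP.
have [c' [V' [gc' c'0 V'0 c'1]]] := Bexp x (of_real k t *: v).
have c00 : c 0 = x by rewrite /c rmorph0 scale0r addr0 fwdK.
have <- : c 1 = h (Tangent x (of_real k t *: v)).
  rewrite -c'1; apply: (geodesic_unique hM gc gc'); first by rewrite c'0.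
  rewrite V'0 c00 Bhom; have := @dchartK _ _ M _ x ax dx (of_real k t *: B x v).
  by rewrite dchart_at.
have J1 : `[0, 1]%classic (1 : R) by rewrite /= in_itv /= lexx ler01.
rewrite (cP 1 J1).2 rmorph1 scale1r => /addrI/scalerI -> //.
by rewrite fmorph_eq0.
Unshelve. all: by end_near. Qed.

Hypothesis Bsqr : forall x v, B x (B x v) = 0.

(** At v = 0 both sides are B_x a, because T h (a, b) = a + B_x b and B_x^2 = 0. Along
t |-> (x,tv) both sides have constant coefficients in charts, as [h] is affine
and [B] is parallel. *)
Lemma exp_field_tmap x v a b :
  B (h (Tangent x v)) (tmap h (Tangent x v) (a, b)) = tmap h (Tangent x v) (0, a).
Proof.
pose c t : tangentBundle M := Tangent x (0 + of_real k t *: v).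
pose P t := forall a b, B (h (c t)) (tmap h (c t) (a, b)) = tmap h (c t) (0, a).
suff : P 1 by rewrite /P /c rmorph1 scale1r add0r; exact.
have J0 : `[0, 1]%classic (0 : R) by rewrite /= in_itv /= lexx ler01.
have J1 : `[0, 1]%classic (1 : R) by rewrite /= in_itv /= lexx ler01.
apply: (@connected_locally_constant R `[0, 1] P (@segment_connected _ 0 1) _ 0 1) => //.
  move=> t Jt; have cc : c s @[s --> within `[0, 1] (nbhs t)] --> c t by exact: fibre_cvg.
  have aX := chart_atP (h (c t)); have dX := dom_chart_at (h (c t)).
  have H1 := cvg_near cc (tmap_near ah aX dX).
  have H2 := cvg_near cc (cvg_near (affine_map_cvg ah (x := c t)) (pB (h (c t)))).
  near=> s.
  have [ds tE] : dom (chart_at (h (c t))) (h (c s)) /\ forall v,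
    dchart (chart_at (h (c t))) (h (c s)) (tmap h (c s) v) =
    dchart (chart_at (h (c t))) (h (c t)) (tmap h (c t) (dchart (chart_at (c t)) (c s) v)).
    exact: (near H1 s).
  have BE : forall v, dchart (chart_at (h (c t))) (h (c s)) (B (h (c s)) v) =
     B (h (c t)) (dchart (chart_at (h (c t))) (h (c s)) v) by exact: (near H2 s).
  have {}tE a' b' : dchart (chart_at (h (c t))) (h (c s)) (tmap h (c s) (a', b')) =
      tmap h (c t) (a', b').
    rewrite tE dchart_at [dchart _ _ _]dchart_tangent ?dchart_at//.
    exact: dom_chart_at.
  split=> H a' b'.
    by rewrite -!tE -BE H.
  by apply: (dchart_inj aX ds); rewrite BE !tE H.
move=> a' b'; rewrite /c rmorph0 scale0r addr0 exp_field_unit.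
rewrite tmap_split (tmap_horizontal exp_field_unit) -[tmap _ _ (0, b')]/(vertical x b').
rewrite -[RHS]/(vertical x a') !exp_field_vertical.
have [L _ LE] := vertical_linear x.
have BL w : B x w = L w by rewrite -exp_field_vertical.
by rewrite !BL linearD -!BL Bsqr addr0.
Unshelve. all: by end_near. Qed.

(** The two sides of the associativity law are the ends of two geodesics with the
same initial vector, by [exp_field_tmap]. *)
Lemma exp_field_algebra : tangent_algebra h.
Proof.
split=> [|[[x v] [a b]]]; first exact: exp_field_unit.
rewrite /tangent_map /mu /=.
have [c [V [gc c0 V0 <-]]] := Bexp (h (Tangent x v)) (tmap h (Tangent x v) (a, b)).
have gc' := geodesic_image ah (geodesic_fibre k `[0, 1] x v a).
rewrite (geodesic_unique hM gc gc'); first by rewrite /= rmorph1 scale1r.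
  by rewrite c0 /= rmorph0 scale0r addr0.
by rewrite V0 exp_field_tmap /= rmorph0 scale0r addr0.
Qed.

End Field.

End TangentAlgebras.

(** * Absolute parallelism *)

Section Restriction.
Context {K : numFieldType} {E : normedModType K} (M : affineAtlas E).
Variables (phi : chart E M) (O : set E).
Hypotheses (aphi : atlas phi) (oO : open O).

Definition restriction_dom : set M := [set y | dom phi y /\ O (phi y)].

Lemma restrictionK x : restriction_dom x -> bwd phi (phi x) = x.
Proof. by move=> [dx _]; exact: fwdK. Qed.

Lemma restriction_image (W : set M) :
  phi @` (restriction_dom `&` W) = O `&` phi @` (dom phi `&` W).
Proof.
apply/seteqP; split=> [_ [y [[dy Oy] Wy] <-]|z [Oz [y [dy Wy] yE]]].
  by split=> //; exists y.
by exists y => //; split=> //; split=> //; rewrite yE.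
Qed.

Lemma restriction_open : open (phi @` restriction_dom).
Proof.
rewrite -[restriction_dom]setIT restriction_image setIT.
by apply: openI => //; exact: open_codom.
Qed.

(** The parallelism is constant only in charts with connected domain, which those of
the atlas need not have; restricting them to a small ball gives such charts. *)
Definition restriction : chart E M := Chart restrictionK restriction_open.

Lemma restriction_affine : affine_chart restriction.
Proof.
move=> psi apsi; have [o1 la1] := atlas_change aphi apsi.
have [o2 la2] := atlas_change apsi aphi.
split; split.
- by rewrite restriction_image; exact: openI.
- by move=> x [dx _]; exact: la1.
- by rewrite setIC; exact: (open_chart_preimage aphi oO).
- by move=> x px [dx _]; exact: la2.
Qed.

End Restriction.

Arguments restriction {K E M} phi {O} oO.
Arguments restriction_affine {K E M phi O} aphi oO.

Section Parallelism.
Context {R : realType} {K : numFieldType} (k : real_or_complex R K).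
Context {E : normedModType K} (M : affineAtlas E) (Phi : absolute_parallelism M).

(** The parallelism is a parallel section of Hom(TM, E): near [x] it is transported
by the chart at [x]. *)
Lemma par_near x : \forall y \near x, forall v,
  Phi y v = Phi x (dchart (chart_at x) y v).
Proof.
have ax := chart_atP x; have dx := dom_chart_at x.
have /nbhs_ballP[r /= r0 rH] := near_chart_image dx.
have oB : open (ball (chart_at x x) r) by exact: ball_open.
pose chi := restriction (chart_at x) oB.
have dchi : dom chi = bwd (chart_at x) @` ball (chart_at x x) r.
  apply/seteqP; split=> [y [dy By]|_ [z Bz <-]].
    by exists (chart_at x y) => //; exact: fwdK.
  by have [dz zE] := rH z Bz; split=> //; rewrite zE.
have cchi : connected (dom chi).
  rewrite dchi; apply: connected_continuous_connected.
    exact: (ball_connected k r0).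
  apply/subspace_continuousP => z Bz; have [dz zE] := rH z Bz.
  by apply: cvg_within_filter; rewrite -{1}zE; exact: bwd_cvg.
have [C CE] := par_constant Phi (restriction_affine ax oB) cchi.
have CE' y v : dom chi y -> Phi y v = C (dchart (chart_at x) y v).
  by move=> dy; rewrite (CE y dy).
have dx' : dom chi x by split=> //; exact: ballxx.
have nx : nbhs x (dom chi).
  by apply: open_nbhs_nbhs; split=> //; exact: (open_chart_preimage ax oB).
apply: filterS nx => y dy v.
by rewrite (CE' y _ dy) (CE' x _ dx') dchart_at.
Qed.

Lemma par_inv_near x : \forall y \near x, forall e,
  dchart (chart_at x) y (par_inv Phi y e) = par_inv Phi x e.
Proof.
apply: filterS (par_near x) => y yE e.
by rewrite -[RHS]/(par_inv Phi x e) -{2}(par_invK Phi y e) yE parK.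
Qed.

End Parallelism.

Lemma manifold_locally_constant (K : numFieldType) (E : normedModType K)
    (M : affineManifold E) (P : M -> Prop) :
  (forall x, \forall y \near x, P y <-> P x) -> forall x y, P x -> P y.
Proof.
move=> lc x y; apply: (connected_locally_constant (am_connected (a := M))) => // z _.
by rewrite near_withinE; apply: filterS (lc z).
Qed.

(** * From parallel fields to endomorphisms of the model space *)

(** A surjective local isomorphism [p] with local sections, [T a] being its tangent
map at [a]. The two instances that matter are the identity of a manifold and the
holonomy covering; [T] is a parameter so that it is the identity for the former. *)
Record tangent_cover (K : numFieldType) (E : normedModType K)
    (M' M : affineAtlas E) (p : M' -> M) (T : M' -> E -> E) : Prop := {
  tc_surj : forall x, exists a, p a = x;
  tc_cvg : forall a, p b @[b --> a] --> p a;
  tc_section : forall a, exists2 q : M -> M', q y @[y --> p a] --> a &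
    \forall y \near p a, p (q y) = y;
  tc_near : forall a, \forall b \near a, forall w,
    dchart (chart_at (p a)) (p b) (T b w) = T a (dchart (chart_at a) b w);
  tc_iso : forall a, exists L L' : {linear E -> E},
    [/\ continuous L, continuous L', cancel L L', cancel L' L & T a =1 L]
}.

Section Covers.
Context {R : realType} {K : numFieldType} (k : real_or_complex R K).
Context {E : normedModType K} (M' M : affineManifold E).
Variables (p : M' -> M) (T : M' -> E -> E) (Phi : absolute_parallelism M').
Hypothesis pT : tangent_cover p T.

(** The action of [A] through the parallelism of [M'] induces [B] at the point below
[a]. *)
Definition lifts_to (A : E -> E) (B : M -> E -> E) (a : M') :=
  forall w, B (p a) (T a w) = T a (par_act Phi A a w).

Lemma par_act_near (A : E -> E) a : \forall b \near a, forall w,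
  dchart (chart_at (p a)) (p b) (T b (par_act Phi A b w)) =
  T a (par_act Phi A a (dchart (chart_at a) b w)).
Proof.
apply: filterS3 (tc_near pT a) (par_near k Phi a) (par_inv_near k Phi a).
by move=> b TE PE PE' w; rewrite TE /par_act PE' PE.
Qed.

(** Both the pulled back field and the action of [A] have constant coefficients in
the charts at [a] and [p a]. *)
Lemma lifts_to_near A B a : parallel_field B ->
  \forall b \near a, lifts_to A B b <-> lifts_to A B a.
Proof.
move=> pB; have pa := tc_cvg pT (a := a).
have dp := cvg_near pa (near_dom (chart_atP (p a)) (dom_chart_at (p a))).
have nB := cvg_near pa (pB (p a)).
have da := near_dom (chart_atP a) (dom_chart_at a).
near=> b.
have db : dom (chart_at a) b by near: b.
have dpb : dom (chart_at (p a)) (p b) by near: b.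
have BE : forall v, dchart (chart_at (p a)) (p b) (B (p b) v) =
  B (p a) (dchart (chart_at (p a)) (p b) v) by near: b.
have TE : forall w, dchart (chart_at (p a)) (p b) (T b w) = T a (dchart (chart_at a) b w).
  by near: b; exact: tc_near.
have AE : forall w, dchart (chart_at (p a)) (p b) (T b (par_act Phi A b w)) =
    T a (par_act Phi A a (dchart (chart_at a) b w)).
  by near: b; exact: par_act_near.
split=> H w.
  by rewrite -(dchart_invK (chart_atP a) db w) -AE -TE -BE H.
by apply: (dchart_inj (chart_atP (p a)) dpb); rewrite BE TE H AE.
Unshelve. all: by end_near. Qed.

(** Near a point of [M] the field is computed on a local section of [p]. *)
Lemma lifts_to_parallel A B : (forall a, lifts_to A B a) -> parallel_field B.
Proof.
move=> AB x; have [a <-] := tc_surj pT x.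
have [q qa pq] := tc_section pT a.
have H1 := cvg_near qa (tc_near pT a).
have H2 := cvg_near qa (par_act_near A a).
apply: filterS3 pq H1 H2 => y yE; rewrite yE => TE AE v.
have [L [L' [_ _ _ LK LE]]] := tc_iso pT (q y).
have vE : v = T (q y) (L' v) by rewrite LE LK.
have := AB (q y) (L' v); rewrite yE -vE => ->.
by rewrite AE vE TE AB -vE.
Qed.

Variable h : tangentBundle M -> M.
Hypothesis ah : affine_map h.

(** Given an algebra, [A] is read off at one point of [M'], and connectedness
of [M'] gives it everywhere. *)
Lemma tangent_algebraP : tangent_algebra h <->
  exists A : {linear E -> E}, [/\ continuous A, forall e, A (A e) = 0 &
    forall x, exists2 B : E -> E,
      (forall a, p a = x -> forall w, B (T a w) = T a (par_act Phi A a w)) &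
      forall v, exp_to k x (B v) (h (Tangent x v))].
Proof.
split=> [[h0 hmu]|[A [cA A0 AH]]].
  have pV := vertical_parallel ah h0.
  have expV := vertical_exp k ah h0.
  (* Connected spaces may be empty; then so is M, and any A will do. *)
  have [[a _]|nM] := pselect (exists a : M', True); last first.
    exists \0; split=> // [|x]; first by move=> e; exact: cvg_cst.
    by have [a] := tc_surj pT x; case: nM; exists a.
  have [L [L' [cL cL' LK L'K LE]]] := tc_iso pT a.
  have [N cN NE] := vertical_linear ah (p a).
  pose A : {linear E -> E} := Phi a \o (L' \o (N \o (L \o par_inv Phi a))).
  have AV : forall b, lifts_to A (vertical h) b.
    move=> b; apply: (manifold_locally_constant (fun c => lifts_to_near A c pV) (x := a)) => w.
    by rewrite /par_act /A /= !LE !parK L'K NE.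
  exists A; split.
  - move=> e; apply: continuous_comp; last exact: par_continuous.
    apply: continuous_comp; last exact: cL'.
    apply: continuous_comp; last exact: cN.
    by apply: continuous_comp; [exact: par_inv_continuous|exact: cL].
  - by move=> e; rewrite /A /= parK L'K -!NE vertical_sqr// !linear0.
  - by move=> x; exists (vertical h x) => // b <- w; exact: AV.
have [B BA Bexp] : exists2 B : M -> E -> E, (forall a, lifts_to A B a) &
    forall x v, exp_to k x (B x v) (h (Tangent x v)).
  exists (fun x => sval (cid2 (AH x))) => [a w|x v]; case: cid2 => /= B.
    by move=> + _; apply.
  by move=> _; apply.
apply: (exp_field_algebra (k := k) ah (B := B)) => //.
- exact: am_hausdorff.
- exact: lifts_to_parallel BA.
- move=> x t v; have [a <-] := tc_surj pT x.
  have [L [L' [_ _ _ L'K LE]]] := tc_iso pT a.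
  rewrite -(L'K v) -linearZ -!LE !BA !LE -[RHS]linearZ.
  by rewrite /par_act !linearZ.
- move=> x v; have [a <-] := tc_surj pT x.
  have [L [L' [_ _ _ L'K LE]]] := tc_iso pT a.
  rewrite -(L'K v) -LE !BA LE /par_act par_invK A0 !linear0 //.
Qed.

End Covers.

Lemma tangent_cover_id (K : numFieldType) (E : normedModType K)
    (M : affineAtlas E) : tangent_cover (@id M) (fun=> id).
Proof.
split=> [x|a|a|a|a].
- by exists x.
- exact: cvg_id.
- by exists id; [exact: cvg_id|near=> y].
- by near=> b.
- by exists idfun, idfun; split=> // x; exact: cvg_id.
Unshelve. all: by end_near. Qed.

(** On a sheet of the covering, [q] is a two-sided local inverse. *)
Lemma covering_local_section (S T : topologicalType) (p : S -> T) (a : S) :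
  covering_map p -> exists q : T -> S, [/\ q y @[y --> p a] --> a,
    \forall y \near p a, p (q y) = y & \forall b \near a, q (p b) = b].
Proof.
move=> [_ _ /(_ (p a))[U [oU Upa] [D [pU _ DP]]]].
have : (\bigcup_(V in D) V) a by rewrite -pU.
move=> [V DV Va]; have [oV [q [cq qU qV]]] := DP V DV.
have nU : nbhs (p a) U by exact: open_nbhs_nbhs.
exists q; split.
- have cq' : q y @[y --> within U (nbhs (p a))] --> q (p a).
    by move/subspace_continuousP : cq; exact.
  rewrite qV// in cq' => P /cq' H.
  have {}H : \forall y \near p a, U y -> P (q y) by exact: H.
  by apply: filterS2 nU H => y Uy; exact.
- by apply: filterS nU => y /qU[].
- have nV : nbhs a V by exact: open_nbhs_nbhs.
  by apply: filterS nV => b; exact: qV.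
Qed.

(** The local inverse of [p] at [a], read in charts, is a local inverse of the linear
map [tmap p a], which is therefore an isomorphism. *)
Lemma tangent_cover_covering (K : numFieldType) (E : normedModType K)
    (M' M : affineAtlas E) (p : M' -> M) : covering_map p -> affine_map p ->
  tangent_cover p (tmap p).
Proof.
move=> cp ap; split=> [x|a|a|a|a].
- have [_ rp _] := cp; have : range p x by rewrite rp.
  by move=> [a _ <-]; exists a.
- exact: affine_map_cvg.
- by have [q [qa pq _]] := covering_local_section a cp; exists q.
- have apa := chart_atP (p a); have dpa := dom_chart_at (p a).
  by apply: filterS (tmap_near ap apa dpa) => b [_ H] w; rewrite H dchart_at.
have [q [qa pq qp]] := covering_local_section a cp.
have apa := chart_atP (p a); have dpa := dom_chart_at (p a).
have aa := chart_atP a; have da := dom_chart_at a.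
have [L cL LE] := tmap_linear ap a.
have sh (G : normedModType K) (z : G) : z + w @[w --> (0 : G)] --> z.
  rewrite -[X in _ --> X]addr0; apply: cvgD; [exact: cvg_cst|exact: cvg_id].
(* The local inverse q of p, read in the charts at p a and a. *)
pose S w := chart_at a (q (bwd (chart_at (p a)) (chart_at (p a) (p a) + w))) - chart_at a a.
have bw := cvg_comp _ _ (sh _ (chart_at (p a) (p a))) (bwd_cvg apa dpa).
have qbw := cvg_comp _ _ bw qa.
have S0 : S w @[w --> (0 : E)] --> (0 : E).
  rewrite -[X in _ --> X](subrr (chart_at a a)); apply: cvgB; last exact: cvg_cst.
  exact: (cvg_comp _ _ qbw (chart_cvg aa da)).
have LS : \forall w \near 0, L (S w) = w.
  have H1 := cvg_near (sh _ (chart_at (p a) (p a))) (near_chart_image dpa).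
  have H2 := cvg_near bw pq.
  have H3 := cvg_near qbw (affine_near ap a).
  apply: filterS3 H1 H2 H3 => w /= [d1 e1] e2 [_ _].
  by rewrite e2 e1 LE => /addrI.
have SL : \forall u \near 0, S (L u) = u.
  have c1 := sh _ (chart_at a a).
  have c2 := cvg_comp _ _ c1 (bwd_cvg aa da).
  have H1 := cvg_near c1 (near_chart_image da).
  have H2 := cvg_near c2 qp.
  have H3 := cvg_near c2 (affine_near ap a).
  apply: filterS3 H1 H2 H3 => u /= [d1 e1] e2 [_ dp].
  rewrite e1 LE [chart_at a a + u]addrC addrK /S => <-.
  by rewrite [u + _]addrC fwdK// e2 e1 addrAC subrr add0r.
have [L' cL' [LL' L'L]] := linear_local_inverse S0 LS SL.
by exists L, L'.
Qed.

(** * Morphisms *)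

Section Morphisms.
Context {R : realType} {K : numFieldType} (k : real_or_complex R K).
Context {E F : normedModType K} (M : affineManifold E) (N : affineManifold F).
Variables (Phi : absolute_parallelism M) (Psi : absolute_parallelism N).

Lemma linear_part_near (f : M -> N) x : affine_map f ->
  \forall y \near x, linear_part Phi Psi f y =1 linear_part Phi Psi f x.
Proof.
move=> af; have a := chart_atP (f x); have d := dom_chart_at (f x).
have H := cvg_near (affine_map_cvg af (x := x)) (par_near k Psi (f x)).
apply: filterS3 (par_inv_near k Phi x) (tmap_near af a d) H.
by move=> y PE [_ TE] PsiE e; rewrite /linear_part PsiE TE PE dchart_at.
Qed.

Variables (h : tangentBundle M -> M) (l : tangentBundle N -> N).
Variables (A : {linear E -> E}) (B : {linear F -> F}) (f : M -> N).
Hypotheses (ah : affine_map h) (al : affine_map l) (af : affine_map f).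
Hypothesis hA : forall x v, exp_to k x (par_act Phi A x v) (h (Tangent x v)).
Hypothesis lB : forall y w, exp_to k y (par_act Psi B y w) (l (Tangent y w)).

(** If [f] is a morphism, compare the initial vectors of s |-> f(h(x,sv)) and
s |-> l(f(x), s Tf v). Conversely, the linear part of [f] is constant on the
connected manifold [M], and both curves are geodesics with the same initial
vector. *)
Lemma algebra_morphismP x : algebra_morphism h l f <->
  (forall e, linear_part Phi Psi f x (A e) = B (linear_part Phi Psi f x e)).
Proof.
have J0 : `[0, 1]%classic (0 : R) by rewrite /= in_itv /= lexx ler01.
have parhom (G : normedModType K) (Q : affineAtlas G)
    (Xi : absolute_parallelism Q) (C : {linear G -> G}) y t v :
    par_act Xi C y (of_real k t *: v) = of_real k t *: par_act Xi C y v.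
  by rewrite /par_act !linearZ.
have vh y v : vertical h y v = par_act Phi A y v.
  by apply: (exp_field_vertical ah (am_hausdorff (a := M)) _ hA) => *; exact: parhom.
have h0 y : h (Tangent y 0) = y.
  by apply: (exp_field_unit (am_hausdorff (a := M)) _ hA) => *; exact: parhom.
have vl y v : vertical l y v = par_act Psi B y v.
  by apply: (exp_field_vertical al (am_hausdorff (a := N)) _ lB) => *; exact: parhom.
split=> [fhl e|fAB].
  set v := par_inv Phi x e.
  have g1 := geodesic_image af (geodesic_image ah (geodesic_fibre k `[0, 1] x 0 v)).
  have g2 := geodesic_image al (geodesic_fibre k `[0, 1] (f x) 0 (tmap f x v)).
  have := (g1 0 J0).1; rewrite /= rmorph0 scale0r addr0 h0.
  have -> : f \o (h \o (fun t => Tangent x (0 + of_real k t *: v))) =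
      l \o (fun t => Tangent (f x) (0 + of_real k t *: tmap f x v)).
    apply: funext => t /=; rewrite fhl /tangent_map /=; congr (l (Tangent _ _)).
    by have [T _ TE] := tmap_linear af x; rewrite !TE !add0r linearZ.
  move=> /velocity_unique/(_ (g2 0 J0).1).
  rewrite /= rmorph0 scale0r addr0 -[tmap h _ _]/(vertical h x v) vh.
  rewrite -[tmap l _ _]/(vertical l (f x) (tmap f x v)) vl.
  by rewrite /linear_part /par_act par_invK => ->; rewrite par_invK.
have fT y v : tmap f y (par_act Phi A y v) = par_act Psi B (f y) (tmap f y v).
  pose P y := forall e, linear_part Phi Psi f y (A e) = B (linear_part Phi Psi f y e).
  have lcP z : \forall w \near z, P w <-> P z.
    apply: filterS (linear_part_near z af) => w wE.
    by split=> H e; have := H e; rewrite !wE.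
  have Py : P y by exact: (manifold_locally_constant lcP (x := x)).
  have := Py (Phi y v); rewrite /linear_part parK => yE.
  by rewrite /par_act -yE parK.
case=> y v; rewrite /tangent_map /=.
have [c [V [gc c0 V0 <-]]] := hA y v.
have [c' [V' [gc' c'0 V'0 <-]]] := lB (f y) (tmap f y v).
apply: (geodesic_unique (am_hausdorff (a := N)) (geodesic_image af gc) gc').
  by rewrite /= c0.
by rewrite V'0 c0 V0 fT.
Qed.

End Morphisms.

Theorem theorem3p1p3 (R : realType) :
  [/\ (* trivial holonomy *)
    forall (K : numFieldType) (k : real_or_complex R K)
      (E : completeNormedModType K) (M : affineManifold E)
      (Phi : absolute_parallelism M) (h : tangentBundle M -> M),
      trivial_holonomy k M -> affine_map h ->
      (tangent_algebra h <->
      exists A : {linear E -> E}, [/\ continuous A, forall e, A (A e) = 0 &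
        forall x v, exp_to k x (par_act Phi A x v) (h (Tangent x v))]),
    (* real and finite-dimensional *)
    forall (E : completeNormedModType R) (M M' : affineManifold E)
      (p : M' -> M) (Phi : absolute_parallelism M') (h : tangentBundle M -> M),
      finite_dimensional E -> holonomy_covering p Phi -> affine_map h ->
      (tangent_algebra h <->
      exists A : {linear E -> E}, [/\ continuous A, forall e, A (A e) = 0 &
        forall x, exists2 B : E -> E, common_action p Phi A x B &
          forall v, exp_to (RealScalars R) x (B v) (h (Tangent x v))]) &
    (* morphisms *)
    forall (K : numFieldType) (k : real_or_complex R K)
      (E F : completeNormedModType K)
      (M : affineManifold E) (N : affineManifold F)
      (Phi : absolute_parallelism M) (Psi : absolute_parallelism N)
      (h : tangentBundle M -> M) (l : tangentBundle N -> N)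
      (A : {linear E -> E}) (B : {linear F -> F}) (f : M -> N),
      trivial_holonomy k M -> trivial_holonomy k N ->
      affine_map h -> tangent_algebra h ->
      affine_map l -> tangent_algebra l ->
      continuous A -> continuous B ->
      (forall x v, exp_to k x (par_act Phi A x v) (h (Tangent x v))) ->
      (forall y w, exp_to k y (par_act Psi B y w) (l (Tangent y w))) ->
      affine_map f ->
      forall x, algebra_morphism h l f <->
        (forall e, linear_part Phi Psi f x (A e) =
                   B (linear_part Phi Psi f x e))].
Proof.
split=> [K k E M Phi h _ ah|E M M' p Phi h _ [[cp ap _] _] ah|].
- have [hA Ah] := tangent_algebraP k Phi (tangent_cover_id M) ah.
  split=> [/hA[A [cA A0 AB]]|[A [cA A0 AB]]].
    exists A; split=> // x v; have [B BE expB] := AB x.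
    by have := expB v; rewrite (BE x erefl v).
  apply: Ah; exists A; split=> // x; exists (par_act Phi A x); last exact: AB.
  by move=> a ->.
- exact: (tangent_algebraP (RealScalars R) Phi (tangent_cover_covering cp ap) ah).
- move=> K k E F M N Phi Psi h l A B f _ _ ah _ al _ _ _ hA lB af x.
  exact: (algebra_morphismP (k := k)).
Qed.
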